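(* Let $\mathcal A\colon\mathcal X\to\mathcal X'$ be Fréchet differentiable, strongly monotone (constant $\alpha$), locally Lipschitz continuous (constants $L[\vartheta]$), with uniformly coercive derivative (constant $\beta$) and locally Lipschitz continuous derivative (constants $M[\vartheta]$), and let $F\in\mathcal X'$. Suppose that the error estimator satisfies stability, reduction, and reliability, and that quasi-orthogonality holds. Let $0<\overline q<1$, $c_0:=2(1-\overline q)^{-1}$, and let the minimal number $k_{\min}\in\mathbb N$ of Newton iterations be chosen such that $$q_0:=\frac{L[(1+c_0)B_0]}{\alpha}\,\overline r_0^{\,k_{\min}}<\overline q<1,$$ with $B_0$ and $\overline r_0$ as defined in the context. Then, for arbitrary $0<\theta\le1$, $C_{\rm mark}\ge1$, and $\lambda_{\rm lin}>0$, the algorithm NAILFEM (described in the context) guarantees full R-linear convergence of the quasi-error $$\mathsf H_\ell^k:=\|F-\mathcal A u_\ell^k\|_{\mathcal X_\ell'}+\eta_\ell(u_\ell^k),\qquad(\ell,k)\in\mathcal Q,$$ i.e., there exist constants $C_{\rm lin}>0$ and $0<q_{\rm lin}<1$ such that $$\mathsf H_\ell^k\le C_{\rm lin}\,q_{\rm lin}^{|\ell,k|-|\ell',k'|}\,\mathsf H_{\ell'}^{k'}\quad\text{for all }(\ell,k),(\ell',k')\in\mathcal Q\text{ with }|\ell',k'|\le|\ell,k|.$$ The constants $C_{\rm lin}$ and $q_{\rm lin}$ are independent of the mesh size and the iteration number, but depend only on $\alpha,\delta_0,k_{\min},q_0,q_{\rm red},\overline r_0,B_0,\overline C_{\rm stab},C_{\text{Céa}},C_{\rm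 rel},C_{\rm orth}(\varepsilon),\delta_{\min},\theta,\lambda_{\rm lin}$, with $C_{\rm orth}(\varepsilon)$ from quasi-orthogonality for some suitably (sufficiently small) chosen $\varepsilon>0$.
   Context: Abstract setting. $\mathcal X$ is a (real) Hilbert space with norm $\|\cdot\|_{\mathcal X}$ induced by its inner product, $\mathcal X'$ its topological dual with dual norm, $\langle\cdot,\cdot\rangle$ the duality pairing. For a closed subspace $\mathcal X_H\subseteq\mathcal X$ and $\phi\in\mathcal X'$, $\|\phi\|_{\mathcal X_H'}:=\sup\{\langle\phi,w_H\rangle: w_H\in\mathcal X_H,\ \|w_H\|_{\mathcal X}=1\}$. Assumptions: - Strong monotonicity: $\alpha>0$ and $\alpha\|v-w\|_{\mathcal X}^2\le\langle\mathcal A v-\mathcal A w,v-w\rangle$ for all $v,w\in\mathcal X$. - Local Lipschitz continuity: for all $\vartheta>0$ there is $L[\vartheta]>0$ with $\langle\mathcal A v-\mathcal A w,\varphi\rangle\le L[\vartheta]\|v-w\|_{\mathcal X}\|\varphi\|_{\mathcal X}$ for all $v,w,\varphi\in\mathcal X$ with $\max\{\|v\|_{\mathcal X},\|v-w\|_{\mathcal X}\}\le\vartheta$. - Uniform coercivity of the derivative: $\beta>0$ and $\beta\|w\|_{\mathcal X}^2\le\langle\mathrm d\mathcal A[v]w,w\rangle$ for all $v,w\in\mathcal X$. - Local Lipschitz continuity of the derivative: for all $\vartheta>0$ there is $M[\vartheta]>0$ with $\|\mathrm d\mathcal A[v]-\mathrm d\mathcal A[w]\|_{\mathcal L(\mathcal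 X,\mathcal X')}\le M[\vartheta]\|v-w\|_{\mathcal X}$ for all $v,w\in\mathcal X$ with $\max\{\|v\|_{\mathcal X},\|v-w\|_{\mathcal X}\}\le\vartheta$; $M[\cdot]$ is monotonically increasing and bounded below by a positive constant. - Standing assumption: $\mathcal A0\ne F$. $u^\star\in\mathcal X$ is the unique solution of $\langle\mathcal A u^\star,v\rangle=\langle F,v\rangle$ for all $v\in\mathcal X$; $u_H^\star\in\mathcal X_H$ is the unique solution of $\langle\mathcal A u_H^\star,v_H\rangle=\langle F,v_H\rangle$ for all $v_H\in\mathcal X_H$. Constants. $B_0:=\alpha^{-1}\|F-\mathcal A0\|_{\mathcal X'}$; $\overline B_0:=\alpha^{-1}L[(1+c_0)B_0](1+c_0)B_0+B_0$; $C_0:=M[\overline B_0]\,L[(1+c_0)B_0]\,(1+c_0)B_0/(2\beta^2)$; $\delta^\star:=\min\{[(16C_0+1)^{1/2}-1]^2/(16C_0^2),\,1\}$; $\delta_0:=2^{-j_0}$ with $j_0\in\mathbb N=\{1,2,\dots\}$ minimal such that $2^{-j_0}\le\delta^\star$; $\overline r_0:=1-\delta_0^{3/2}/2\in(0,1)$ (the guaranteed residual reduction factor of the adaptively damped Newton step, independent of the discrete space); $C_{\text{Céa}}:=L[2B_0]/\alpha$; $\overline C_{\rm stab}:=C_{\rm stab}[2\overline B_0]$. Meshes and spaces. $\Omega\subset\mathbb R^d$ is a polyhedral bounded Lipschitz domain, $\mathcal T_0$ an initial conforming simplicial triangulation. For a conforming triangulation $\mathcal T_H$ and $\mathcal M_H\subseteq\mathcal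 T_H$, $\mathtt{refine}(\mathcal T_H,\mathcal M_H)$ is the coarsest conforming refinement by newest-vertex bisection (NVB) in which at least all elements of $\mathcal M_H$ are refined. $\mathbb T(\mathcal T_H)$ is the set of triangulations obtained from $\mathcal T_H$ by finitely many NVB steps, $\mathbb T:=\mathbb T(\mathcal T_0)$. For fixed $p\in\mathbb N$, $\mathcal X_H:=\mathcal S_0^p(\mathcal T_H):=\{v\in H_0^1(\Omega): v|_T$ is a polynomial of degree $\le p$ for all $T\in\mathcal T_H\}\subset\mathcal X$; index $\ell$ refers to $\mathcal T_\ell$. Estimator. For each $\mathcal T_H\in\mathbb T$, $T\in\mathcal T_H$, $v_H\in\mathcal X_H$, $\eta_H(T,v_H)\ge0$ is given; $\eta_H(\mathcal U_H,v_H):=(\sum_{T\in\mathcal U_H}\eta_H(T,v_H)^2)^{1/2}$ for $\mathcal U_H\subseteq\mathcal T_H$ and $\eta_H(v_H):=\eta_H(\mathcal T_H,v_H)$. For all $\mathcal T_H\in\mathbb T$, $\mathcal T_h\in\mathbb T(\mathcal T_H)$: - Stability: for all $\vartheta>0$ there is $C_{\rm stab}[\vartheta]>0$ such that $|\eta_h(\mathcal U_H,v_h)-\eta_H(\mathcal U_H,v_H)|\le C_{\rm stab}[\vartheta]\|v_h-v_H\|_{\mathcal X}$ for all $\mathcal U_H\subseteq\mathcal T_h\cap\mathcal T_H$ and all $v_h\in\mathcal X_h$, $v_H\in\mathcal X_H$ with $\max\{\|v_h\|_{\mathcal X},\|v_h-v_H\|_{\mathcal X}\}\le\vartheta$. -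 Reduction: there is $0<q_{\rm red}<1$ with $\eta_h(\mathcal T_h\setminus\mathcal T_H,v_H)\le q_{\rm red}\,\eta_H(\mathcal T_H\setminus\mathcal T_h,v_H)$ for all $v_H\in\mathcal X_H$. - Reliability: there is $C_{\rm rel}>0$ with $\|u^\star-u_H^\star\|_{\mathcal X}\le C_{\rm rel}\,\eta_H(u_H^\star)$. - Quasi-orthogonality (for the nested sequence of spaces $\mathcal X_\ell$ generated by the algorithm): for any $0<\varepsilon<1$ there is $C_{\rm orth}(\varepsilon)>0$ such that $\sum_{\ell'=\ell}^{\ell+n}\big[\|u_{\ell'+1}^\star-u_{\ell'}^\star\|_{\mathcal X}^2-\varepsilon\,\eta_{\ell'}(u_{\ell'}^\star)^2\big]\le C_{\rm orth}(\varepsilon)\,\eta_\ell(u_\ell^\star)^2$ for all $\ell,n\in\mathbb N_0$ (for which the involved levels exist, i.e. $\ell+n+1\le\underline\ell$). Algorithm NAILFEM. Input: $u_0^0:=0$, $0<\theta\le1$, $C_{\rm mark}\ge1$, $\lambda_{\rm lin}>0$, $k_{\min}\ge1$, initial value $\delta_{\min}:=1/2$. For $\ell=0,1,\dots$: (1) For $k=0,1,\dots$: (a) compute $\varrho_\ell^k\in\mathcal X_\ell$ with $\langle\mathrm d\mathcal A[u_\ell^k]\varrho_\ell^k,v_\ell\rangle=\langle F-\mathcal A u_\ell^k,v_\ell\rangle$ for all $v_\ell\in\mathcal X_\ell$; (b) initialize $\delta:=1$; as long as $\|F-\mathcal A(u_\ell^k+\delta\varrho_\ell^k)\|_{\mathcal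 X_\ell'}\le(1-\delta_{\min}^{3/2}/2)\|F-\mathcal A u_\ell^k\|_{\mathcal X_\ell'}$ fails, replace $\delta$ by $\delta/2$ and then $\delta_{\min}$ by $\min\{\delta,\delta_{\min}\}$ ($\delta_{\min}$ is carried over through all $k$ and $\ell$); (c) set $u_\ell^{k+1}:=u_\ell^k+\delta\varrho_\ell^k$; (d) if $k+1\ge k_{\min}$ and $\|F-\mathcal A u_\ell^{k+1}\|_{\mathcal X_\ell'}\le\lambda_{\rm lin}\eta_\ell(u_\ell^{k+1})$, stop the $k$-loop and set $\underline k[\ell]:=k+1$. (2) Determine $\mathcal M_\ell\subseteq\mathcal T_\ell$ with $\theta\,\eta_\ell(u_\ell^{\underline k})^2\le\eta_\ell(\mathcal M_\ell,u_\ell^{\underline k})^2$ and cardinality at most $C_{\rm mark}$ times the minimal cardinality of sets with this property. (3) $\mathcal T_{\ell+1}:=\mathtt{refine}(\mathcal T_\ell,\mathcal M_\ell)$, $u_{\ell+1}^0:=u_\ell^{\underline k}$. Index sets. $\overline{\mathcal Q}$ is the set of all $(\ell,k)\in\mathbb N_0^2$ for which $u_\ell^k$ is computed; $\underline k[\ell]:=\sup\{k:(\ell,k)\in\overline{\mathcal Q}\}\in\mathbb N\cup\{\infty\}$; $\mathcal Q:=\overline{\mathcal Q}\setminus\{(\ell,\underline k[\ell]):(\ell+1,0)\in\overline{\mathcal Q}\}$; $\underline\ell:=\sup\{\ell:(\ell,0)\in\mathcal Q\}\in\mathbb N_0\cup\{\infty\}$. Abbreviation $u_\ell^{\underline k}:=u_\ell^{\underline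 k[\ell]}$. The total step counter is $|\ell,k|:=\#\{(\ell',k')\in\mathcal Q:(\ell',k')$ appears earlier in the algorithm than $(\ell,k)\}=k+\sum_{\ell'=0}^{\ell-1}\underline k[\ell']$. *)

(* Defs.v *)
From HB Require Import structures.
From mathcomp Require Import all_boot all_order all_algebra finmap.
From mathcomp Require Import all_classical all_reals all_analysis.

Set Implicit Arguments.
Unset Strict Implicit.
Unset Printing Implicit Defensive.

Import Order.TTheory GRing.Theory Num.Theory.
Import numFieldNormedType.Exports.
Local Open Scope classical_set_scope.
Local Open Scope ring_scope.

(* R^d as a measurable space: the product sigma-algebra of d copies of the
   Borel sigma-algebra of the real line. *)
Notation tupR R d := (d.-tuple (measurableTypeR R)).

Section LebesgueRd.
Context {R : realType}.

Definition tuple_consp d (p : measurableTypeR R * tupR R d) : tupR R d.+1 :=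
  [tuple of p.1 :: p.2].

Lemma measurable_tuple_consp d :
  measurable_fun [set: measurableTypeR R * tupR R d] (@tuple_consp d).
Proof. exact: measurable_cons. Qed.

Section step.
Context (d : nat) (m : {sigma_finite_measure set (tupR R d) -> \bar R}).

Definition lebesgue_step : set (tupR R d.+1) -> \bar R :=
  pushforward (@lebesgue_measure R \x m)%E (@tuple_consp d).

HB.instance Definition _ := Measure.copy lebesgue_step
  (measure_function_pushforward__canonical__measure_function_Measure
     (@lebesgue_measure R \x m)%E (@measurable_tuple_consp d)).

Lemma lebesgue_step_sigma_finite : sigma_finite [set: tupR R d.+1] lebesgue_step.
Proof.
have /sigma_finiteP[F [TF ndF Foo]] := sigma_finiteT (@lebesgue_measure R).
have /sigma_finiteP[G [TG ndG Goo]] := sigma_finiteT m.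
pose g (t : tupR R d.+1) : measurableTypeR R * tupR R d :=
  (tnth t ord0, [tuple of behead t]).
have gK p : g (tuple_consp p) = p.
  by case: p => x t; congr pair; apply/val_inj.
have mg : measurable_fun setT g.
  apply/measurable_fun_pairP; split; first exact: measurable_tnth.
  exact: measurable_behead.
exists (fun n => g @^-1` (F n `*` G n)).
  rewrite predeqE => t; split=> // _.
  have : [set: measurableTypeR R] (g t).1 by [].
  rewrite TF => -[i _ Fi]; have : [set: tupR R d] (g t).2 by [].
  rewrite TG => -[j _ Gj]; exists (maxn i j) => //; split.
    by move: Fi; exact/subsetPset/ndF/leq_maxl.
  by move: Gj; exact/subsetPset/ndG/leq_maxr.
move=> n; have [mF Fn] := Foo n; have [mG Gn] := Goo n; split.
  by rewrite -[X in measurable X]setTI; apply: mg => //; exact: measurableX.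
rewrite /lebesgue_step /pushforward (_ : _ @^-1` _ = F n `*` G n).
  by rewrite product_measure1E// lte_mul_pinfty// ge0_fin_numE.
rewrite -comp_preimage (_ : g \o _ = id) ?preimage_id//.
by apply/funext => p; exact: gK.
Qed.

HB.instance Definition _ := Measure_isSigmaFinite.Build _ _ _ lebesgue_step
  lebesgue_step_sigma_finite.

End step.

Fixpoint lebesgueRd d : {sigma_finite_measure set (tupR R d) -> \bar R} :=
  match d with
  | 0 => dirac ([tuple] : tupR R 0)
  | d'.+1 => lebesgue_step (lebesgueRd d')
  end.

End LebesgueRd.

(* The identification of R^d with the normed space 'rV[R]_d, which carries the
   topology and the geometry. *)
Definition rV_of_tuple {R : realType} d (t : tupR R d) : 'rV[R]_d :=
  \row_i tnth t i.

Definition sq_integral {R : realType} d (Omega : set 'rV[R]_d)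
    (f : 'rV[R]_d -> R) : \bar R :=
  (\int[lebesgueRd d]_(t in (@rV_of_tuple R d) @^-1` Omega)
     ((f (rV_of_tuple t) ^+ 2)%:E))%E.

Definition ae_eq_on {R : realType} d (D : set 'rV[R]_d)
    (f g : 'rV[R]_d -> R) : Prop :=
  {ae lebesgueRd d, forall t : tupR R d,
     D (rV_of_tuple t) -> f (rV_of_tuple t) = g (rV_of_tuple t)}.

Definition borel_fun {R : realType} d (f : 'rV[R]_d -> R) : Prop :=
  measurable_fun setT (f \o @rV_of_tuple R d : tupR R d -> measurableTypeR R).

Section Sobolev.
Context {R : realType} (d : nat).
Implicit Types (Omega : set 'rV[R]_d) (f v : 'rV[R]_d -> R).

Definition dotv (x y : 'rV[R]_d) : R := \sum_i x ord0 i * y ord0 i.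

(* Near each boundary point, Omega is the set of points lying, in some unit
   direction e, strictly above the graph of a Lipschitz function over the
   hyperplane orthogonal to e (only the values of g on it are used). *)
Definition lipschitz_boundary Omega : Prop :=
  forall x, closure Omega x -> ~ Omega x ->
  exists (r K : R) (e : 'rV[R]_d) (g : 'rV[R]_d -> R),
    [/\ 0 < r, dotv e e = 1,
        forall y z, `|g y - g z| <= K * `|y - z| &
        forall z, `|z - x| < r ->
          (Omega z <-> g (z - dotv z e *: e) < dotv z e)].

Definition bounded_lipschitz_domain Omega : Prop :=
  [/\ open Omega, connected Omega, Omega !=set0, bounded_set Omega &
      lipschitz_boundary Omega].

Fixpoint Cn (n : nat) f : Prop :=
  match n with
  | 0 => continuous f
  | n'.+1 => continuous f /\
      forall i : 'I_d, (forall x, derivable f x (delta_mx ord0 i)) /\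
                       Cn n' (fun x => 'D_(delta_mx ord0 i) f x)
  end.

Definition Cinfty_c Omega f : Prop :=
  (forall n, Cn n f) /\
  exists K : set 'rV[R]_d,
    [/\ compact K, K `<=` Omega & forall x, ~ K x -> f x = 0].

(* The closure of Cinfty_c Omega in H^1(Omega); the limits gr i of the partial
   derivatives are the weak partial derivatives of v.  An element of H^1_0 is
   represented by a Borel function, up to equality a.e. in Omega. *)
Definition H10 Omega v : Prop :=
  borel_fun v /\
  exists (gr : 'I_d -> 'rV[R]_d -> R) (phi : nat -> 'rV[R]_d -> R),
    [/\ forall i, borel_fun (gr i),
        forall n, Cinfty_c Omega (phi n),
        sq_integral Omega (fun x => phi n x - v x) @[n --> \oo] --> 0%E &
        forall i, sq_integral Omega
          (fun x => 'D_(delta_mx ord0 i) (phi n) x - gr i x)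
          @[n --> \oo] --> 0%E].

Definition poly_deg_le (p : nat) f : Prop :=
  exists c : {ffun 'I_d -> 'I_p.+1} -> R, forall x,
    f x = \sum_(m : {ffun 'I_d -> 'I_p.+1} | (\sum_i (m i : nat) <= p)%N)
            c m * \prod_i x ord0 i ^+ m i.

End Sobolev.

(* A simplex of R^d is the ordered list (x_0, ..., x_d) of its vertices with a
   type in {0, ..., d - 1}: the data on which newest-vertex bisection operates
   (Maubach, Traxler, Stevenson); the refinement edge is x_0 x_d. *)
Notation simplex R d := (seq 'rV[R]_d * nat)%type.
Notation mesh R d := {fset simplex R d}.

Section Meshes.
Context {R : realType} (d : nat).
Implicit Types (s : seq 'rV[R]_d) (T : simplex R d) (TH Th : mesh R d).

Definition conv_hull s : set 'rV[R]_d :=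
  [set x | exists a : 'I_(size s) -> R,
     [/\ forall i, 0 <= a i, \sum_i a i = 1 & x = \sum_i a i *: s`_i]].

Definition affinely_independent s : Prop :=
  forall a : 'I_(size s) -> R,
    \sum_i a i = 0 -> \sum_i a i *: s`_i = 0 -> forall i, a i = 0.

Definition is_simplex T : Prop :=
  [/\ size T.1 = d.+1, affinely_independent T.1 & (T.2 < d)%N].

(* The intersection of two elements is the convex hull of their common
   vertices (a common face, or empty), and no element occurs twice with
   different vertex orderings or types. *)
Definition conforming TH : Prop :=
  forall T T', T \in TH -> T' \in TH ->
    conv_hull T.1 `&` conv_hull T'.1 = conv_hull [seq x <- T.1 | x \in T'.1] /\
    (T.1 =i T'.1 -> T = T').

Definition conforming_triangulation (Omega : set 'rV[R]_d) TH : Prop :=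
  [/\ forall T, T \in TH -> is_simplex T, conforming TH &
      closure Omega = \bigcup_(T in [set` TH]) conv_hull T.1].

(* Bisection of (x_0, ..., x_d) of type g at the midpoint z of x_0 x_d into
     (x_0, z, x_1, ..., x_g, x_(g+1), ..., x_(d-1)) and
     (x_d, z, x_1, ..., x_g, x_(d-1), ..., x_(g+1)),
   both of type g + 1 mod d. *)
Definition children T : simplex R d * simplex R d :=
  let x0 := head 0 T.1 in
  let xd := last 0 T.1 in
  let z := 2^-1 *: (x0 + xd) in
  let mid := take d.-1 (behead T.1) in
  ((x0 :: z :: mid, (T.2.+1 %% d)%N),
   (xd :: z :: take T.2 mid ++ rev (drop T.2 mid), (T.2.+1 %% d)%N)).

Inductive nvb_steps TH : mesh R d -> Prop :=
| nvb_none : nvb_steps TH TH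
| nvb_step Th T : nvb_steps TH Th -> T \in Th ->
    nvb_steps TH
      ((Th `\ T) `|` [fset (children T).1; (children T).2])%fset.

Definition refinement TH Th : Prop := nvb_steps TH Th /\ conforming Th.

Definition refines_marked TH (MH : {fset simplex R d}) Th : Prop :=
  refinement TH Th /\ [disjoint MH & Th]%fset.

(* Th = refine(TH, MH): the coarsest refinement in which all marked elements
   are refined. *)
Definition is_refine TH MH Th : Prop :=
  refines_marked TH MH Th /\
  forall Th', refines_marked TH MH Th' -> refinement Th Th'.

Definition S0p (Omega : set 'rV[R]_d) (p : nat) TH (v : 'rV[R]_d -> R) : Prop :=
  H10 Omega v /\
  forall T, T \in TH ->
    exists2 q, poly_deg_le p q & ae_eq_on (conv_hull T.1) v q.

End Meshes.

Section Hilbert.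
Context {R : realType} {X : completeNormedModType R}.

(* The norm of the complete space X is induced by the inner product ip. *)
Definition inner_product_norm (ip : X -> X -> R) : Prop :=
  [/\ forall a x y z, ip (a *: x + y) z = a * ip x z + ip y z,
      forall x y, ip x y = ip y x &
      forall x, `|x| ^+ 2 = ip x x].

(* phi \in X': an element of the dual space is a function phi : X -> R, and the
   duality pairing <phi, w> is the application phi w. *)
Definition in_dual (phi : X -> R) : Prop := scalar phi /\ continuous phi.

(* If V = {0}, the supremum is over the empty set, whose sup is 0. *)
Definition dual_norm (V : set X) (phi : X -> R) : R :=
  sup [set phi w | w in V `&` [set w | `|w| = 1]].

(* Norm of L(X, X'). *)
Definition op_norm (B : X -> X -> R) : R :=
  sup [set dual_norm setT (B w) | w in [set w | `|w| = 1]].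

(* The inclusion of H^1_0(Omega) in X, as a linear map iota on representatives
   identifying exactly those that agree a.e. in Omega. *)
Definition embeds_H10 d (Omega : set 'rV[R]_d)
    (iota : ('rV[R]_d -> R) -> X) : Prop :=
  (forall (a : R) v w, H10 Omega v -> H10 Omega w ->
     iota (fun x => a * v x + w x) = a *: iota v + iota w) /\
  (forall v w, H10 Omega v -> H10 Omega w ->
     (iota v = iota w <-> ae_eq_on Omega v w)).

Definition fe_space d (Omega : set 'rV[R]_d) (iota : ('rV[R]_d -> R) -> X)
    (p : nat) (TH : mesh R d) : set X :=
  [set iota v | v in S0p Omega p TH].

Implicit Types (A : X -> X -> R) (dA : X -> X -> X -> R) (L M : R -> R).

Definition frechet_derivative A dA : Prop :=
  forall v,
    [/\ forall w, in_dual (dA v w),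
        forall (a : R) w w' x, dA v (a *: w + w') x = a * dA v w x + dA v w' x,
        exists C : R, forall w, dual_norm setT (dA v w) <= C * `|w| &
        dual_norm setT (fun x => A (v + h) x - A v x - dA v h x) / `|h|
          @[h --> (0 : X)^'] --> (0 : R)].

Definition strongly_monotone (alpha : R) A : Prop :=
  0 < alpha /\
  forall v w, alpha * `|v - w| ^+ 2 <= A v (v - w) - A w (v - w).

Definition locally_lipschitz L A : Prop :=
  forall theta, 0 < theta -> 0 < L theta /\
  forall v w phi, Num.max `|v| `|v - w| <= theta ->
    A v phi - A w phi <= L theta * `|v - w| * `|phi|.

Definition uniformly_coercive (beta : R) dA : Prop :=
  0 < beta /\ forall v w, beta * `|w| ^+ 2 <= dA v w w.

Definition derivative_locally_lipschitz M dA : Prop :=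
  [/\ forall theta, 0 < theta -> forall v w,
        Num.max `|v| `|v - w| <= theta ->
        op_norm (fun x y => dA v x y - dA w x y) <= M theta * `|v - w|,
      forall s t, 0 < s -> s <= t -> M s <= M t &
      exists2 m : R, 0 < m & forall t, 0 < t -> m <= M t].

Definition galerkin_solution A (F : X -> R) (V : set X) (u : X) : Prop :=
  V u /\ forall v, V v -> A u v = F v.

End Hilbert.

Section Constants.
Context {R : realType}.

Definition B0_const (X : completeNormedModType R) (alpha : R)
    (A : X -> X -> R) (F : X -> R) : R :=
  alpha^-1 * dual_norm setT (fun w => F w - A 0 w).

Definition c0_const (qbar : R) : R := 2 * (1 - qbar)^-1.

Definition Bbar0_const (alpha : R) (L : R -> R) (c0 B0 : R) : R :=
  alpha^-1 * L ((1 + c0) * B0) * (1 + c0) * B0 + B0.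

Definition C0_const (beta : R) (L M : R -> R) (c0 B0 Bbar0 : R) : R :=
  M Bbar0 * L ((1 + c0) * B0) * (1 + c0) * B0 / (2 * beta ^+ 2).

Definition delta_star (C0 : R) : R :=
  Num.min ((Num.sqrt (16 * C0 + 1) - 1) ^+ 2 / (16 * C0 ^+ 2)) 1.

(* The search for j0 starts at 1, so delta0 <= 1/2. *)
Definition is_delta0 (dstar delta0 : R) : Prop :=
  exists j0 : nat,
    [/\ (1 <= j0)%N, delta0 = 2 ^- j0, 2 ^- j0 <= dstar &
        forall j : nat, (1 <= j)%N -> 2 ^- j <= dstar -> (j0 <= j)%N].

Definition reduction_factor (delta : R) : R := 1 - delta `^ (3 / 2) / 2.

End Constants.

Section Estimator.
Context {R : realType} {X : completeNormedModType R} (d : nat).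
Context (VH : mesh R d -> set X) (T0 : mesh R d).
Context (eta : mesh R d -> simplex R d -> X -> R).
Implicit Types (TH Th U : mesh R d) (v : X).

Definition eta_on TH U v : R := Num.sqrt (\sum_(T <- U) eta TH T v ^+ 2).

Definition eta_tot TH v : R := eta_on TH TH v.

Definition estimator_nonneg : Prop :=
  forall TH T v, refinement T0 TH -> T \in TH -> VH TH v -> 0 <= eta TH T v.

Definition stability (Cstab : R -> R) : Prop :=
  forall theta, 0 < theta -> 0 < Cstab theta /\
  forall TH Th, refinement T0 TH -> refinement TH Th ->
  forall U vh vH, (U `<=` Th `&` TH)%fset -> VH Th vh -> VH TH vH ->
    Num.max `|vh| `|vh - vH| <= theta ->
    `|eta_on Th U vh - eta_on TH U vH| <= Cstab theta * `|vh - vH|.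

Definition reduction (qred : R) : Prop :=
  0 < qred < 1 /\
  forall TH Th, refinement T0 TH -> refinement TH Th ->
  forall vH, VH TH vH ->
    eta_on Th (Th `\` TH)%fset vH <= qred * eta_on TH (TH `\` Th)%fset vH.

Definition reliability (ustar : X) (ustarH : mesh R d -> X) (Crel : R) : Prop :=
  0 < Crel /\
  forall TH, refinement T0 TH ->
    `|ustar - ustarH TH| <= Crel * eta_tot TH (ustarH TH).

End Estimator.

(* The sequences produced by an execution: the meshes T_l, the iterates u_l^k,
   and the value of delta_min at the start of step (l, k).  Only the entries
   with computed indices are meaningful. *)
Record trace (R : realType) (X : completeNormedModType R) (d : nat) := Trace {
  tr_mesh : nat -> mesh R d;
  tr_u : nat -> nat -> X;
  tr_dmin : nat -> nat -> R
}.

Section Algorithm.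
Context {R : realType} {X : completeNormedModType R} (d : nat).
Context (VH : mesh R d -> set X) (T0 : mesh R d).
Context (A : X -> X -> R) (dA : X -> X -> X -> R) (F : X -> R).
Context (eta : mesh R d -> simplex R d -> X -> R).
Context (theta Cmark lam : R) (kmin : nat).
Implicit Types (TH MH U : mesh R d) (u rho : X) (tr : trace X d).

Definition residual TH u : R := dual_norm (VH TH) (fun w => F w - A u w).

Definition newton_direction TH u rho : Prop :=
  VH TH rho /\ forall v, VH TH v -> dA u rho v = F v - A u v.

Definition sufficient_decrease TH u rho (delta dmin : R) : Prop :=
  residual TH (u + delta *: rho) <= reduction_factor dmin * residual TH u.

(* line_search TH u rho delta dmin delta' dmin': the damping loop entered with
   the values delta, dmin terminates with the values delta', dmin'. *)
Inductive line_search TH u rho : R -> R -> R -> R -> Prop :=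
| ls_stop delta dmin :
    sufficient_decrease TH u rho delta dmin ->
    line_search TH u rho delta dmin delta dmin
| ls_halve delta dmin delta' dmin' :
    ~ sufficient_decrease TH u rho delta dmin ->
    line_search TH u rho (delta / 2) (Num.min (delta / 2) dmin) delta' dmin' ->
    line_search TH u rho delta dmin delta' dmin'.

Definition newton_step TH u (dmin : R) u' (dmin' : R) : Prop :=
  exists rho delta,
    [/\ newton_direction TH u rho,
        line_search TH u rho 1 dmin delta dmin' &
        u' = u + delta *: rho].

(* As 1 <= kmin, the criterion cannot hold before the first Newton step. *)
Definition stopping TH (k : nat) u : Prop :=
  (kmin <= k)%N /\ residual TH u <= lam * eta_tot eta TH u.

Definition doerfler TH u MH : Prop :=
  (MH `<=` TH)%fset /\
  theta * eta_tot eta TH u ^+ 2 <= eta_on eta TH MH u ^+ 2.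

Definition marked TH u MH : Prop :=
  doerfler TH u MH /\
  forall U, doerfler TH u U -> #|` MH|%:R <= Cmark * #|` U|%:R.

Inductive computed tr : nat -> nat -> Prop :=
| computed_init : computed tr 0 0
| computed_newton l k u' dmin' :
    computed tr l k -> ~ stopping (tr_mesh tr l) k (tr_u tr l k) ->
    newton_step (tr_mesh tr l) (tr_u tr l k) (tr_dmin tr l k) u' dmin' ->
    computed tr l k.+1
| computed_refine l k :
    computed tr l k -> stopping (tr_mesh tr l) k (tr_u tr l k) ->
    computed tr l.+1 0.

Definition nailfem tr : Prop :=
  [/\ tr_mesh tr 0 = T0, tr_u tr 0 0 = 0, tr_dmin tr 0 0 = 2^-1,
      forall l k, computed tr l k.+1 ->
        newton_step (tr_mesh tr l) (tr_u tr l k) (tr_dmin tr l k)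
                    (tr_u tr l k.+1) (tr_dmin tr l k.+1) &
      forall l k, computed tr l k ->
        stopping (tr_mesh tr l) k (tr_u tr l k) ->
        [/\ exists2 MH, marked (tr_mesh tr l) (tr_u tr l k) MH &
              is_refine (tr_mesh tr l) MH (tr_mesh tr l.+1),
            tr_u tr l.+1 0 = tr_u tr l k &
            tr_dmin tr l.+1 0 = tr_dmin tr l k]].

(* k = sup { k' : (l, k') is computed }, the supremum being finite. *)
Definition is_kbar tr (l k : nat) : Prop :=
  computed tr l k /\ forall k', computed tr l k' -> (k' <= k)%N.

Definition Qset tr : set (nat * nat) :=
  [set lk | computed tr lk.1 lk.2 /\
            ~ (is_kbar tr lk.1 lk.2 /\ computed tr lk.1.+1 0)].

Definition earlier (lk lk' : nat * nat) : Prop :=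
  (lk.1 < lk'.1)%N \/ lk.1 = lk'.1 /\ (lk.2 < lk'.2)%N.

(* The total step counter |l, k|; the set is finite for computed (l, k). *)
Definition step_counter tr (lk : nat * nat) : nat :=
  #|` fset_set (Qset tr `&` [set lk' | earlier lk' lk])|.

(* l <= sup { l' : (l', 0) \in Q } *)
Definition level_exists tr (l : nat) : Prop :=
  exists2 l', (l <= l')%N & Qset tr (l', 0%N).

Definition quasi_error tr (lk : nat * nat) : R :=
  residual (tr_mesh tr lk.1) (tr_u tr lk.1 lk.2) +
  eta_tot eta (tr_mesh tr lk.1) (tr_u tr lk.1 lk.2).

Definition quasi_orthogonality tr (ustarH : mesh R d -> X)
    (Corth : R -> R) : Prop :=
  forall eps, 0 < eps < 1 -> 0 < Corth eps /\
  forall l n, level_exists tr (l + n).+1 ->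
    \sum_(l <= i < (l + n).+1)
       (`|ustarH (tr_mesh tr i.+1) - ustarH (tr_mesh tr i)| ^+ 2 -
        eps * eta_tot eta (tr_mesh tr i) (ustarH (tr_mesh tr i)) ^+ 2)
    <= Corth eps * eta_tot eta (tr_mesh tr l) (ustarH (tr_mesh tr l)) ^+ 2.

End Algorithm.

(* Main.v *)
Require Import Defs.
From mathcomp Require Import all_boot all_order all_algebra finmap.
From mathcomp Require Import all_classical all_reals all_analysis measurable_realfun.
From mathcomp Require Import ring lra zify.

(** Write r for the residual of an iterate in the dual norm of its discrete space.

    Within a level, a Newton step damped by delta changes the residual by the
    factor 1 - delta + C0 delta^2 at most (newton_residual_le), where C0 comes from
    the Lipschitz bound on the derivative in a ball that contains all iterates.
    This is at most 1 - delta^(3/2) / 2 as soon as delta <= delta_star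
    (delta_starP), so the line search stops at delta0 at the latest and dmin stays
    above delta0 (line_search_dmin): every step multiplies r by rbar0 at most.
    The existence of a common ball is part of the same induction
    (invariant_computed): kmin steps multiply the error by q0 < qbar, and the
    change of the discrete space moves the Galerkin solution by at most 2 B0, so
    the initial error of every level is at most (1 + c0) B0.

    Across the levels, let x = e + w h combine the error e and the estimator h of
    the final iterate of a level.  The estimator reduction caused by marking
    (doerfler_reduction) and the contraction of e by q0 give
    x (l + 1) <= q x l + d l with q < 1, where d is the distance of consecutive
    Galerkin solutions (level_contraction).  Squares being summed,
    quasi-orthogonality bounds the sum of d^2 by a small multiple of the sum of
    x^2 plus a multiple of the first term; absorbing the former shows that the
    tail sums of x^2 are bounded by their first terms (level_tail_sum).

    The two scales fit together because the quasi-error decays geometrically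
    inside a level, up to a constant (quasi_error_in_level), starts each level at
    a multiple of x of the level before (quasi_error_next_level), and dominates
    x of its own level (level_quantity_le).  Hence the tail sums of the squared
    quasi-error along the enumeration of all steps are bounded by their first
    terms (quasi_error_tail_sum); this implies linear convergence
    (tail_sum_geometric), and the position of a step in the enumeration is the
    total step counter (card_earlier). *)

Set Implicit Arguments.
Unset Strict Implicit.
Unset Printing Implicit Defensive.

Import Order.TTheory GRing.Theory Num.Theory.
Import numFieldNormedType.Exports.
Local Open Scope classical_set_scope.
Local Open Scope ring_scope.

(** * Bisection and nested finite element spaces *)

Section NestedMeshes.
Context {R : realType} (d : nat).
Implicit Types (s : seq 'rV[R]_d) (T : simplex R d) (TH Th : mesh R d).

Lemma conv_hull_vertex s x : x \in s -> conv_hull s x.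
Proof.
move=> xs; have ix : (index x s < size s)%N by rewrite index_mem.
exists (fun i => (i == Ordinal ix)%:R); split=> [i||].
- by rewrite ler0n.
- by rewrite (bigD1 (Ordinal ix))//= eqxx big1 ?addr0// => i /negPf ->.
- rewrite (bigD1 (Ordinal ix))//= eqxx scale1r nth_index// big1 ?addr0//.
  by move=> i /negPf ->; rewrite scale0r.
Qed.

Lemma conv_hull_sub s s' :
  (forall x, x \in s' -> conv_hull s x) -> conv_hull s' `<=` conv_hull s.
Proof.
move=> ss' _ [a [a0 a1 ->]].
have /choice[b bP] : forall i : 'I_(size s'), exists b : 'I_(size s) -> R,
   [/\ forall j, 0 <= b j, \sum_j b j = 1 & s'`_i = \sum_j b j *: s`_j].
  by move=> i; exact: ss' (mem_nth _ _).
exists (fun j => \sum_i a i * b i j); split=> [j||].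
- by rewrite sumr_ge0// => i _; rewrite mulr_ge0//; case: (bP i).
- rewrite exchange_big/= -[RHS]a1; apply: eq_bigr => i _.
  by rewrite -mulr_sumr; case: (bP i) => _ -> _; rewrite mulr1.
- under eq_bigr => i _.
    case: (bP i) => _ _ ->; rewrite scaler_sumr.
    under eq_bigr do rewrite scalerA.
    over.
  by rewrite exchange_big/=; apply: eq_bigr => j _; rewrite scaler_suml.
Qed.

Lemma conv_hull_midpoint s x y : conv_hull s x -> conv_hull s y ->
  conv_hull s (2^-1 *: (x + y)).
Proof.
move=> sx sy; apply: (@conv_hull_sub s [:: x; y]).
  by move=> z; rewrite !inE => /orP[] /eqP ->.
exists (fun=> 2^-1); split=> //=.
- by rewrite !big_ord_recl big_ord0 /=; lra.
- by rewrite !big_ord_recl big_ord0 /= addr0 scalerDr.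
Qed.

(** Every vertex of a child is a vertex of its parent or the midpoint of its
    refinement edge.  The list of vertices must be nonempty: the default vertex 0
    would otherwise enter. *)
Lemma children_sub T T' : (0 < size T.1)%N ->
    T' = (children T).1 \/ T' = (children T).2 ->
  (0 < size T'.1)%N /\ conv_hull T'.1 `<=` conv_hull T.1.
Proof.
case: T => s g /=; case: s => // x s _ TT'.
have hx : conv_hull (x :: s) x by apply: conv_hull_vertex; rewrite inE eqxx.
have hl : conv_hull (x :: s) (last x s) by apply: conv_hull_vertex; exact: mem_last.
have hz := conv_hull_midpoint hx hl.
have ht y : y \in take d.-1 s -> conv_hull (x :: s) y.
  by move=> /mem_take ys; apply: conv_hull_vertex; rewrite inE ys orbT.
case: TT' => ->; split=> //; apply: conv_hull_sub => y; rewrite /= !inE.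
  by move=> /or3P[/eqP->|/eqP->|/ht].
rewrite mem_cat mem_rev -mem_cat cat_take_drop.
by move=> /or3P[/eqP->|/eqP->|/ht].
Qed.

Lemma nvb_steps_sub TH Th : (forall T, T \in TH -> (0 < size T.1)%N) ->
    nvb_steps TH Th -> forall T', T' \in Th ->
  (0 < size T'.1)%N /\ exists2 T, T \in TH & conv_hull T'.1 `<=` conv_hull T.1.
Proof.
move=> TH0; elim=> [|Th' T _ IH TTh'] T' .
  by move=> T'TH; split; [exact: TH0|exists T'].
have [T0 [T1 T1TH TT1]] := IH _ TTh'.
rewrite in_fsetU in_fsetD1 => /orP[/andP[_ /IH]//|].
rewrite in_fset2 => /orP T'c.
have /(children_sub T0)[? T'T] : T' = (children T).1 \/ T' = (children T).2.
  by case: T'c => /eqP; [left|right].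
by split=> //; exists T1 => //; exact: subset_trans TT1.
Qed.

Lemma nvb_steps_trans TH Tk Th :
  nvb_steps TH Tk -> nvb_steps Tk Th -> nvb_steps TH Th.
Proof. by move=> HTk; elim=> // Th' T _ HTh' TTh'; exact: nvb_step. Qed.

Lemma refinement_refl TH : conforming TH -> refinement TH TH.
Proof. by split=> //; exact: nvb_none. Qed.

Lemma refinement_trans TH Tk Th :
  refinement TH Tk -> refinement Tk Th -> refinement TH Th.
Proof. by move=> [HTk _] [Hkh ?]; split=> //; exact: nvb_steps_trans Hkh. Qed.

(** The polynomial that represents v on an element also represents it on every
    part of that element, so refinement only adds functions. *)
Lemma S0p_refine Omega p TH Th : (forall T, T \in TH -> (0 < size T.1)%N) ->
  nvb_steps TH Th -> S0p Omega p TH `<=` S0p Omega p Th.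
Proof.
move=> TH0 HTh v [H1v pv]; split=> // T' /(nvb_steps_sub TH0 HTh)[_ [T TTH T'T]].
have [q pq vq] := pv _ TTH; exists q => //.
by move: vq; apply: filterS => t vq T't; exact/vq/T'T.
Qed.

Lemma fe_space_refine (X : completeNormedModType R)
    (iota : ('rV[R]_d -> R) -> X) Omega p (T0 TH Th : mesh R d) :
    conforming_triangulation Omega T0 -> refinement T0 TH -> refinement TH Th ->
  fe_space Omega iota p TH `<=` fe_space Omega iota p Th.
Proof.
move=> [sT0 _ _] [T0H _] [HTh _] _ [v pv <-]; exists v => //.
apply: S0p_refine pv => // T TTH.
have T00 T1 : T1 \in T0 -> (0 < size T1.1)%N by move=> /sT0[->].
by have [] := nvb_steps_sub T00 T0H TTH.
Qed.

End NestedMeshes.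

(** * Measurability of continuous functions *)

Section BorelRd.
Context {R : realType} (d : nat).
Implicit Types (Omega : set 'rV[R]_d) (f g : 'rV[R]_d -> R).

(** The open sets of the normed space are Borel in the product
    sigma-algebra because each is the union of the countably many cubes with
    rational centre and radius that it contains. *)
Lemma measurable_open_rV Omega : open Omega ->
  measurable ((@rV_of_tuple R d) @^-1` Omega).
Proof.
move=> oO.
pose cube (c : 'rV[rat]_d * rat) : set 'rV[R]_d :=
  [set y | forall j, `|ratr (c.1 ord0 j) - y ord0 j| < ratr c.2].
pose I := [set c | cube c `<=` Omega].
have -> : (@rV_of_tuple R d) @^-1` Omega =
    \bigcup_(c in I) ((@rV_of_tuple R d) @^-1` cube c).
  apply/seteqP; split=> [t Ot|t [c cI ct]]; last exact: cI ct.
  set y := rV_of_tuple t in Ot.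
  have /nbhs_ballP[e /= e0 yO] : nbhs y Omega by exact: open_nbhs_nbhs.
  have e20 : 0 < e / 2 by rewrite divr_gt0.
  have [r /andP[r0 re]] : exists r : rat, 0 < (ratr r : R) < e / 2.
    by have [r] := rat_in_itvoo e20; rewrite in_itv/=; exists r.
  have /choice[c cP] : forall j, exists c : rat, `|ratr c - y ord0 j| < ratr r.
    move=> j; have [|c] := @rat_in_itvoo R (y ord0 j) (y ord0 j + ratr r).
      by rewrite ltrDl.
    rewrite in_itv/= => /andP[c1 c2]; exists c.
    by rewrite gtr0_norm ?subr_gt0// ltrBlDl.
  exists (\row_j c j, r); last by move=> j /=; rewrite mxE; exact: cP.
  move=> z /= cz; apply: yO; split=> // i j; rewrite ord1 /ball /=.
  have := cP j; have := cz j; rewrite mxE => h1 h2.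
  rewrite -(subrK (ratr (c j)) (y ord0 j)) -addrA.
  rewrite (le_lt_trans (ler_normD _ _))// (splitr e) ltrD//.
    by rewrite distrC (lt_trans h2).
  exact: lt_trans h1 re.
rewrite bigcup_mkcond; apply: countable_bigcupT_measurable => [|c]; first exact: countableP.
case: ifP => _; last exact: measurable0.
have -> : (@rV_of_tuple R d) @^-1` cube c = \bigcap_(j in [set: 'I_d])
    ((@tnth d (measurableTypeR R) ^~ j) @^-1` ball (ratr (c.1 ord0 j) : R) (ratr c.2 : R)).
  apply/seteqP; split=> t /= ct j; last by rewrite mxE; exact: ct.
  by move=> _; have := ct j; rewrite mxE.
apply: fin_bigcap_measurable => // j _.
rewrite -[X in measurable X]setTI; apply: measurable_tnth => //.
exact: measurable_ball.
Qed.

Lemma continuous_borel f : continuous f -> borel_fun f.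
Proof.
move=> cf; rewrite /borel_fun; apply: (measurability _ (RGenOpens.measurableE R)).
move=> _ [_ [a [b ->]] <-]; rewrite setTI comp_preimage.
apply: measurable_open_rV; move/continuousP: cf; apply.
exact: interval_open.
Qed.
End BorelRd.

(** * The finite element space is a linear space *)

Section H10Linear.
Context {R : realType} (d : nat).
Implicit Types (Omega : set 'rV[R]_d) (f g v w : 'rV[R]_d -> R).

Lemma continuous_lin (a : R) f g : continuous f -> continuous g ->
  continuous (fun x => a * f x + g x).
Proof.
move=> cf cg x.
have cfx : f @ x --> f x by exact: cf.
have cgx : g @ x --> g x by exact: cg.
by apply: cvgD cgx; apply: cvgM cfx; exact: cvg_cst.
Qed.

Lemma derive_lin (a : R) f g x u : derivable f x u -> derivable g x u ->
  derivable (fun y => a * f y + g y) x u /\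
  'D_u (fun y => a * f y + g y) x = a * 'D_u f x + 'D_u g x.
Proof.
move=> df dg; have daf : derivable (a \*: f) x u by exact: derivableZ.
split; first exact: (derivableD daf dg).
by rewrite (deriveD daf dg) deriveZ.
Qed.

Lemma Cn_lin n (a : R) f g : Cn n f -> Cn n g -> Cn n (fun x => a * f x + g x).
Proof.
elim: n f g => [|n IH] f g /=; first exact: continuous_lin.
move=> [cf df] [cg dg]; split=> [|i]; first exact: continuous_lin.
have [df1 df2] := df i; have [dg1 dg2] := dg i; split=> [x|].
  by have [] := derive_lin a (df1 x) (dg1 x).
have -> : (fun x => 'D_(delta_mx ord0 i) (fun y => a * f y + g y) x) =
          (fun x => a * 'D_(delta_mx ord0 i) f x + 'D_(delta_mx ord0 i) g x).
  by apply/funext => x; have [] := derive_lin a (df1 x) (dg1 x).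
exact: IH.
Qed.

Lemma Cinfty_c_lin Omega (a : R) f g : Cinfty_c Omega f -> Cinfty_c Omega g ->
  Cinfty_c Omega (fun x => a * f x + g x).
Proof.
move=> [fn [K [cK KO K0]]] [gn [K' [cK' KO' K0']]].
split=> [n|]; first exact: Cn_lin.
exists (K `|` K'); split; first exact: compactU.
  by rewrite subUset.
by move=> x /not_orP[Kx K'x]; rewrite K0// K0'// mulr0 addr0.
Qed.

Lemma borel_lin (a : R) f g : borel_fun f -> borel_fun g ->
  borel_fun (fun x => a * f x + g x).
Proof.
by move=> bf bg; apply: measurable_funD => //; exact: measurable_funM.
Qed.

Lemma borel_sub f g : borel_fun f -> borel_fun g ->
  borel_fun (fun x => f x - g x).
Proof. by move=> bf bg; exact: measurable_funB. Qed.

(** Pointwise (a y + z)^2 <= 2 a^2 y^2 + 2 z^2; additivity of the integral is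
    where the functions have to be Borel. *)
Lemma sq_integral_lin_le Omega (a : R) f g : open Omega ->
    borel_fun f -> borel_fun g ->
  (sq_integral Omega (fun x => a * f x + g x)%R
    <= (2 * a ^+ 2)%:E * sq_integral Omega f + 2%:E * sq_integral Omega g)%E.
Proof.
move=> oO bf bg; have mO := measurable_open_rV oO.
have msq h : borel_fun h -> measurable_fun ((@rV_of_tuple R d) @^-1` Omega)
    (fun t => (h (rV_of_tuple t) ^+ 2)%:E).
  move=> bh; apply/measurable_EFinP; apply: (@measurable_funS _ _ _ _ setT) => //.
  exact: measurable_funX.
have sq0 h (c : R) t : (0 <= c)%R -> (0 <= c%:E * (h (@rV_of_tuple R d t) ^+ 2)%:E)%E.
  by move=> c0; rewrite -EFinM lee_fin mulr_ge0 ?sqr_ge0.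
have IZ h (c : R) : (0 <= c)%R -> borel_fun h -> (c%:E * sq_integral Omega h =
    \int[lebesgueRd d]_(t in (@rV_of_tuple R d) @^-1` Omega)
      (c%:E * (h (rV_of_tuple t) ^+ 2)%:E))%E.
  move=> c0 bh; rewrite -ge0_integralZl//; first exact: msq.
  by move=> t _; rewrite lee_fin sqr_ge0.
have a20 : 0 <= 2 * a ^+ 2 by rewrite mulr_ge0 ?sqr_ge0.
have maf := measurable_funeM (2 * a ^+ 2)%:E (msq _ bf).
have mag := measurable_funeM 2%:E (msq _ bg).
rewrite !IZ// -ge0_integralD//; last 2 first.
- by move=> t _; apply: sq0; rewrite ?a20 ?ler0n.
- by move=> t _; apply: sq0; rewrite ?a20 ?ler0n.
apply: ge0_le_integral => //.
- by move=> t _; rewrite lee_fin sqr_ge0.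
- exact: (msq _ (borel_lin a bf bg)).
- exact: emeasurable_funD.
- move=> t _; rewrite -!EFinM -EFinD lee_fin.
  set y := f _; set z := g _.
  have := sqr_ge0 (a * y - z); rewrite !expr2; lra.
Qed.

Lemma sq_integral_ge0 Omega f : (0 <= sq_integral Omega f)%E.
Proof. by apply: integral_ge0 => t _; rewrite lee_fin sqr_ge0. Qed.

Lemma sq_integral_lin_cvg0 Omega (a : R) (f g : nat -> 'rV[R]_d -> R) :
    open Omega -> (forall n, borel_fun (f n)) -> (forall n, borel_fun (g n)) ->
    sq_integral Omega (f n) @[n --> \oo] --> 0%E ->
    sq_integral Omega (g n) @[n --> \oo] --> 0%E ->
  sq_integral Omega (fun x => a * f n x + g n x) @[n --> \oo] --> 0%E.
Proof.
move=> oO bf bg f0 g0.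
apply: (@squeeze_cvge _ _ _ _ (cst 0%E) _ (fun n =>
  (2 * a ^+ 2)%:E * sq_integral Omega (f n) + 2%:E * sq_integral Omega (g n))%E).
- by apply: nearW => n; rewrite sq_integral_ge0 sq_integral_lin_le.
- exact: cvg_cst.
- have -> : 0%E = ((2 * a ^+ 2)%:E * 0 + 2%:E * 0)%E :> \bar R.
    by rewrite !mule0 adde0.
  by apply: cvgeD; [rewrite !mule0|exact: cvgeZl|exact: cvgeZl].
Qed.

(** Combining the approximating sequences of v and w approximates a v + w; the
    differences to the limits are Borel because smooth functions are. *)
Lemma H10_lin Omega (a : R) v w : open Omega -> H10 Omega v -> H10 Omega w ->
  H10 Omega (fun x => a * v x + w x).
Proof.
move=> oO [bv [gv [phi [bgv cphi phiv Dphiv]]]].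
move=> [bw [gw [psi [bgw cpsi psiw Dpsiw]]]].
have Dborel f i : Cinfty_c Omega f ->
    borel_fun (fun x => 'D_(delta_mx ord0 i) f x).
  by move=> [/(_ 1%N)[_ /(_ i)[_ cf]] _]; exact: continuous_borel.
have fborel f : Cinfty_c Omega f -> borel_fun f.
  by move=> [/(_ 0%N) cf _]; exact: continuous_borel.
split; first exact: borel_lin.
exists (fun i x => a * gv i x + gw i x), (fun n x => a * phi n x + psi n x).
split=> [i|n||i].
- exact: borel_lin.
- exact: Cinfty_c_lin.
- have -> : (fun n => sq_integral Omega
        (fun x => a * phi n x + psi n x - (a * v x + w x))) =
      (fun n => sq_integral Omega
        (fun x => a * (phi n x - v x) + (psi n x - w x))).
    by apply/funext => n; congr sq_integral; apply/funext => x; ring.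
  apply: sq_integral_lin_cvg0 => // n; apply: borel_sub => //; exact: fborel.
- have -> : (fun n => sq_integral Omega (fun x =>
        'D_(delta_mx ord0 i) (fun y => a * phi n y + psi n y) x -
        (a * gv i x + gw i x))) =
      (fun n => sq_integral Omega (fun x =>
        a * ('D_(delta_mx ord0 i) (phi n) x - gv i x) +
        ('D_(delta_mx ord0 i) (psi n) x - gw i x))).
    apply/funext => n; congr sq_integral; apply/funext => x.
    have [/(_ 1%N)[_ /(_ i)[dp _]] _] := cphi n.
    have [/(_ 1%N)[_ /(_ i)[dq _]] _] := cpsi n.
    by have [_ ->] := derive_lin a (dp x) (dq x); ring.
  apply: sq_integral_lin_cvg0 => // n; apply: borel_sub => //; exact: Dborel.
Qed.

Lemma poly_deg_le_lin p (a : R) f g : poly_deg_le p f -> poly_deg_le p g ->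
  poly_deg_le p (fun x => a * f x + g x).
Proof.
move=> [c fE] [c' gE]; exists (fun m => a * c m + c' m) => x.
rewrite fE gE mulr_sumr -big_split /=; apply: eq_bigr => m _; ring.
Qed.

Lemma S0p_lin Omega p TH (a : R) v w : open Omega ->
  S0p Omega p TH v -> S0p Omega p TH w ->
  S0p Omega p TH (fun x => a * v x + w x).
Proof.
move=> oO [Hv pv] [Hw pw]; split=> [|T TTH]; first exact: H10_lin.
have [q pq vq] := pv _ TTH; have [r pr wr] := pw _ TTH.
exists (fun x => a * q x + r x); first exact: poly_deg_le_lin.
by move: vq wr; apply: filterS2 => t vq wr Tt; rewrite vq// wr.
Qed.

Lemma fe_space_lin (X : completeNormedModType R)
    (iota : ('rV[R]_d -> R) -> X) Omega p (TH : mesh R d) (a : R) (x y : X) :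
    open Omega -> embeds_H10 Omega iota ->
  fe_space Omega iota p TH x -> fe_space Omega iota p TH y ->
  fe_space Omega iota p TH (a *: x + y).
Proof.
move=> oO [iotaL _] [v pv <-] [w pw <-].
exists (fun z => a * v z + w z); first exact: S0p_lin.
by rewrite iotaL//; [case: pv|case: pw].
Qed.

End H10Linear.

(** * Dual norms on subspaces *)

Section DualNorm.
Context {R : realType} {X : completeNormedModType R}.
Implicit Types (V : set X) (phi psi : X -> R).

Definition is_subspace V : Prop :=
  V 0 /\ forall (a : R) x y, V x -> V y -> V (a *: x + y).

Lemma subspaceT : is_subspace setT. Proof. by []. Qed.

Lemma subspaceZ V a x : is_subspace V -> V x -> V (a *: x).
Proof. by move=> [V0 VL] Vx; rewrite -[_ *: _]addr0; exact: VL. Qed.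

Lemma subspaceB V x y : is_subspace V -> V x -> V y -> V (x - y).
Proof. by move=> [V0 VL] Vx Vy; rewrite addrC -scaleN1r; exact: VL. Qed.

Lemma in_dual0 phi : in_dual phi -> phi 0 = 0.
Proof.
move=> [/(_ (-1) 0 0) + _].
by rewrite scaler0 addr0 mulN1r addNr.
Qed.

Lemma in_dualZ phi a w : in_dual phi -> phi (a *: w) = a * phi w.
Proof.
by move=> dphi; case: (dphi) => /(_ a w 0); rewrite in_dual0// !addr0.
Qed.

Lemma in_dualN phi w : in_dual phi -> phi (- w) = - phi w.
Proof. by move=> dphi; rewrite -scaleN1r in_dualZ// mulN1r. Qed.

Lemma in_dual_sub phi psi : in_dual phi -> in_dual psi ->
  in_dual (fun w => phi w - psi w).
Proof.
move=> [lp cp] [lq cq]; split=> [a v w|x].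
  by rewrite lp lq mulrBr opprD addrACA.
have px : phi @ x --> phi x by exact: cp.
have qx : psi @ x --> psi x by exact: cq.
exact: cvgB px qx.
Qed.

Lemma in_dual_bounded phi : in_dual phi ->
  exists C : R, forall w, phi w <= C * `|w|.
Proof.
move=> dphi; have [_ cphi] := dphi.
have /cvgr_dist_lt/(_ 1 ltr01) : phi @ (0 : X) --> phi 0 by exact: cphi.
rewrite in_dual0// => /nbhs_ballP[e /= e0 phie].
exists (2 / e) => w; have [->|w0] := eqVneq w 0.
  by rewrite in_dual0// normr0 mulr0.
have nw0 : 0 < `|w| by rewrite normr_gt0.
have := phie ((e / 2 / `|w|) *: w).
rewrite -ball_normE /ball_/= !sub0r !normrN => /(_ _)/wrap[].
  by rewrite normrZ gtr0_norm ?divr_gt0// divfK ?gt_eqF//; lra.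
rewrite in_dualZ// => h.
have : e / 2 / `|w| * phi w < 1 by exact: le_lt_trans (ler_norm _) h.
have -> : e / 2 / `|w| * phi w = phi w / (2 / e * `|w|).
  by field; rewrite !gt_eqF.
rewrite ltr_pdivrMr; last by rewrite mulr_gt0 ?divr_gt0.
by move/ltW; rewrite mul1r.
Qed.

Lemma dual_norm_le V phi C : 0 <= C ->
  (forall w, V w -> `|w| = 1 -> phi w <= C) -> dual_norm V phi <= C.
Proof.
move=> C0 phiC; rewrite /dual_norm; set S := [set _ | _ in _].
have [->|S0] := eqVneq S set0; first by rewrite sup0.
apply: ge_sup; first exact/set0P.
by move=> _ [w [Vw w1] <-]; exact: phiC.
Qed.

Lemma le_dual_norm V phi w : is_subspace V -> in_dual phi -> V w ->
  phi w <= dual_norm V phi * `|w|.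
Proof.
move=> sV dphi Vw; have [->|w0] := eqVneq w 0.
  by rewrite in_dual0// normr0 mulr0.
have nw0 : 0 < `|w| by rewrite normr_gt0.
rewrite -ler_pdivrMr// mulrC -in_dualZ//; apply: ub_le_sup.
  have [C phiC] := in_dual_bounded dphi; exists C => _ [v [_ v1] <-].
  by rewrite (le_trans (phiC v))// v1 mulr1.
exists (`|w|^-1 *: w) => //; split; first exact: subspaceZ.
by rewrite /= normrZ normfV normr_id mulVf// gt_eqF.
Qed.

Lemma norm_le_dual_norm V phi w : is_subspace V -> in_dual phi -> V w ->
  `|phi w| <= dual_norm V phi * `|w|.
Proof.
move=> sV dphi Vw; rewrite ler_norml le_dual_norm// andbT lerNl -in_dualN//.
rewrite -(normrN w) le_dual_norm// -scaleN1r; exact: subspaceZ.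
Qed.

(** On the zero space the supremum is over the empty set and equals 0. *)
Lemma dual_norm_ge0 V phi : is_subspace V -> in_dual phi ->
  0 <= dual_norm V phi.
Proof.
move=> sV dphi; have [[w [Vw w1]]|nw] := pselect (exists w, V w /\ `|w| = 1).
  by have := norm_le_dual_norm sV dphi Vw; rewrite w1 mulr1; apply: le_trans.
rewrite /dual_norm; set S := [set _ | _ in _]; suff -> : S = set0 by rewrite sup0.
by rewrite -subset0 => y [w Vw _]; apply: nw; exists w.
Qed.

Lemma dual_norm_leT V phi : in_dual phi -> dual_norm V phi <= dual_norm setT phi.
Proof.
move=> dphi; apply: dual_norm_le; first exact: dual_norm_ge0.
by move=> w _ w1; rewrite (le_trans (le_dual_norm subspaceT dphi _))// w1 mulr1.
Qed.

Lemma dual_norm_gt0 phi : in_dual phi -> (exists w, phi w != 0) ->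
  0 < dual_norm setT phi.
Proof.
move=> dphi [w pw]; have := norm_le_dual_norm subspaceT dphi (I : setT w).
rewrite lt_neqAle dual_norm_ge0// andbT => h; apply/eqP => h0.
by move: h; rewrite -h0 mul0r normr_le0; apply/negP.
Qed.

End DualNorm.

(** * Galerkin solutions: error and residual *)

Section Galerkin.
Context {R : realType} {X : completeNormedModType R}.
Context (A : X -> X -> R) (F : X -> R) (alpha : R) (L : R -> R).
Hypotheses (dA_ : forall v, in_dual (A v)) (dF : in_dual F).
Hypothesis monA : strongly_monotone alpha A.
Implicit Types (V : set X) (u : X).

Definition residual_on V u : R := dual_norm V (fun w => F w - A u w).

Lemma in_dual_res u : in_dual (fun w => F w - A u w).
Proof. exact: in_dual_sub. Qed.

Lemma residual_on_ge0 V u : is_subspace V -> 0 <= residual_on V u.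
Proof. by move=> sV; apply: dual_norm_ge0 => //; exact: in_dual_res. Qed.

(** Test strong monotonicity with the error us - u, which lies in V, so that A us
    may be replaced by F. *)
Lemma error_le_residual V us u : is_subspace V -> galerkin_solution A F V us ->
  V u -> `|us - u| <= alpha^-1 * residual_on V u.
Proof.
move=> sV [Vus usF] Vu; have [a0 mA] := monA.
have Ve : V (us - u) by exact: subspaceB.
have [->|e0] := eqVneq (us - u) 0.
  by rewrite normr0 mulr_ge0 ?invr_ge0 ?(ltW a0)// residual_on_ge0.
rewrite ler_pdivlMl// -(ler_pM2r (_ : 0 < `|us - u|)) ?normr_gt0//.
rewrite -mulrA -expr2 (le_trans (mA us u))// usF//.
exact: (le_dual_norm sV (in_dual_res u) Ve).
Qed.

Lemma residual_le_error V us u theta : is_subspace V ->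
    locally_lipschitz L A -> galerkin_solution A F V us -> 0 < theta ->
    Num.max `|us| `|us - u| <= theta ->
  residual_on V u <= L theta * `|us - u|.
Proof.
move=> sV lipA [Vus usF] t0 ust; have [L0 lip] := lipA _ t0.
apply: dual_norm_le => [|w Vw w1]; first by rewrite mulr_ge0// ltW.
by rewrite -usF// (le_trans (lip us u w ust))// w1 mulr1.
Qed.

Lemma galerkin_norm_le V us : is_subspace V -> galerkin_solution A F V us ->
  `|us| <= B0_const alpha A F.
Proof.
move=> sV gus; rewrite -[us]subr0; have [a0 _] := monA.
apply: (le_trans (error_le_residual sV gus _)); first by case: sV.
by rewrite ler_pM2l ?invr_gt0//; apply: dual_norm_leT; exact: in_dual_res.
Qed.

Lemma B0_const_gt0 : A 0 <> F -> 0 < B0_const alpha A F.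
Proof.
move=> AF; have [a0 _] := monA; rewrite mulr_gt0 ?invr_gt0//.
apply: dual_norm_gt0; first exact: in_dual_res.
apply: contrapT => nw; apply: AF; apply/funext => w; apply/eqP.
by rewrite eq_sym -subr_eq0; apply: contrapT => /negP ?; apply: nw; exists w.
Qed.

End Galerkin.

(** * One damped Newton step *)

Section Newton.
Context {R : realType} {X : completeNormedModType R}.
Context (A : X -> X -> R) (dA : X -> X -> X -> R) (F : X -> R).
Context (alpha beta : R) (M : R -> R).
Hypotheses (dA_ : forall v, in_dual (A v)) (dF : in_dual F).
Hypothesis monA : strongly_monotone alpha A.
Hypothesis frA : frechet_derivative A dA.
Hypothesis coA : uniformly_coercive beta dA.
Hypothesis lipdA : derivative_locally_lipschitz M dA.
Implicit Types (V : set X) (u v w h x y : X).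

Lemma in_dual_derivative v h : in_dual (dA v h).
Proof. by have [] := frA v. Qed.

Lemma derivativeZ v (a : R) h w : dA v (a *: h) w = a * dA v h w.
Proof.
have [_ dlin _ _] := frA v.
have d0 : dA v 0 w = 0.
  by have := dlin (-1) 0 0 w; rewrite scaler0 addr0 mulN1r addNr.
by have := dlin a h 0 w; rewrite d0 !addr0.
Qed.

(** The radius r does not depend on the test function w, since the remainder is
    small in the dual norm. *)
Lemma frechet_expansion v (e : R) : 0 < e -> exists2 r : R, 0 < r &
  forall h w, `|h| < r -> `|A (v + h) w - A v w - dA v h w| <= e * `|h| * `|w|.
Proof.
move=> e0; have [_ dlin _ /cvgrPdist_lt/(_ _ e0)] := frA v.
move=> /nbhs_ballP[r /= r0 hr]; exists r => // h w hr0.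
have dual_rem : in_dual (fun x => A (v + h) x - A v x - dA v h x).
  by apply: in_dual_sub; [exact: in_dual_sub|exact: in_dual_derivative].
have [->|h0] := eqVneq h 0.
  have := derivativeZ v 0 0 w; rewrite scale0r mul0r => ->.
  by rewrite addr0 subrr subr0 !normr0 mulr0 mul0r.
apply: le_trans (norm_le_dual_norm subspaceT dual_rem I) _.
rewrite ler_wpM2r//; have nh0 : 0 < `|h| by rewrite normr_gt0.
have := hr h; rewrite -ball_normE /ball_/= !sub0r !normrN => /(_ hr0 h0).
rewrite normrM normfV normr_id ltr_pdivrMr// => /ltW.
by rewrite ger0_norm// dual_norm_ge0.
Qed.

(** Testing the monotonicity of A along the segment from v to v + t w and
    letting t tend to 0 transfers the constant alpha to the derivative, which
    bounds the Newton update by the residual independently of beta. *)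
Lemma derivative_coercive v w : alpha * `|w| ^+ 2 <= dA v w w.
Proof.
have [a0 mA] := monA.
have [->|w0] := eqVneq w 0.
  by rewrite normr0 expr0n mulr0 (in_dual0 (in_dual_derivative v 0)).
have nw0 : 0 < `|w| by rewrite normr_gt0.
apply/ler_addgt0Pr => e e0.
have e'0 : 0 < e / `|w| ^+ 2 by rewrite divr_gt0 ?exprn_gt0.
have [r r0 hr] := frechet_expansion v e'0.
pose t := r / 2 / `|w|; have t0 : 0 < t by rewrite !divr_gt0.
have ntw : `|t *: w| = t * `|w| by rewrite normrZ gtr0_norm.
have := hr (t *: w) w; rewrite ntw divfK ?gt_eqF// => /(_ _)/wrap[].
  by rewrite ltr_pdivrMr// ltr_pMr// ltr1n.
have := mA (v + t *: w) v; rewrite (addrC v) addrK addrC ntw.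
rewrite !(in_dualZ _ _ (dA_ _)) derivativeZ.
rewrite -/t => h1 /(le_trans (ler_norm _)) h2.
have h3 : r / 2 = t * `|w| by rewrite divfK ?gt_eqF.
have h4 : e / `|w| ^+ 2 * (r / 2) * `|w| = t * e.
  by rewrite h3; field; rewrite gt_eqF.
rewrite h4 in h2; rewrite -(ler_pM2l t0) mulrDr.
move: h1 h2; rewrite -mulrBr => h1 h2.
have h5 : t * (alpha * `|w| ^+ 2) <= A (v + t *: w) w - A v w.
  by rewrite -(ler_pM2l t0); lra.
lra.
Qed.

Lemma derivative_diff_le u v theta x y : 0 < theta ->
    Num.max `|u| `|u - v| <= theta ->
  dA u x y - dA v x y <= M theta * `|u - v| * `|x| * `|y|.
Proof.
move=> t0 uvt; have [lip _ _] := lipdA.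
have [x0|x0] := eqVneq x 0.
  have d0 z : dA z x y = 0.
    by have := derivativeZ z 0 0 y; rewrite scale0r mul0r x0.
  by rewrite !d0 subrr x0 normr0 mulr0 mul0r.
have nx0 : 0 < `|x| by rewrite normr_gt0.
pose x' := `|x|^-1 *: x.
have x'1 : `|x'| = 1 by rewrite normrZ normfV normr_id mulVf// gt_eqF.
have dB w : in_dual (fun z => dA u w z - dA v w z).
  by apply: in_dual_sub; exact: in_dual_derivative.
have -> : dA u x y - dA v x y = `|x| * (dA u x' y - dA v x' y).
  by rewrite /x' !derivativeZ; field; rewrite gt_eqF.
have -> : M theta * `|u - v| * `|x| * `|y| = `|x| * (M theta * `|u - v| * `|y|).
  by ring.
rewrite ler_pM2l//.
apply: le_trans (le_dual_norm subspaceT (dB x') I) _.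
rewrite ler_wpM2r//; apply: le_trans (lip _ t0 _ _ uvt).
have [_ _ [Cu uC] _] := frA u; have [_ _ [Cv vC] _] := frA v.
apply: ub_le_sup; last by exists x'.
exists (Cu + Cv) => _ [w /= w1 <-]; apply: dual_norm_le => [|z _ z1].
  have := le_trans (dual_norm_ge0 subspaceT (in_dual_derivative u w)) (uC w).
  have := le_trans (dual_norm_ge0 subspaceT (in_dual_derivative v w)) (vC w).
  by rewrite w1; lra.
have := norm_le_dual_norm subspaceT (in_dual_derivative u w) (I : setT z).
have := norm_le_dual_norm subspaceT (in_dual_derivative v w) (I : setT z).
move: (uC w) (vC w); rewrite w1 z1 !mulr1 !ler_norml.
by move=> ? ? /andP[? ?] /andP[? ?]; lra.
Qed.

Lemma is_derive_along u h w (t : R) :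
  is_derive t 1 (fun s : R => A (u + s *: h) w) (dA (u + t *: h) h w).
Proof.
have key : (fun s : R => s^-1 *: (A (u + (s *: 1 + t) *: h) w - A (u + t *: h) w))
    @ 0^' --> dA (u + t *: h) h w.
  apply/cvgrPdist_le => e e0.
  have e'0 : 0 < e / (`|h| * `|w| + 1).
    by rewrite divr_gt0// ltr_wpDl// mulr_ge0.
  have [r r0 hr] := frechet_expansion (u + t *: h) e'0.
  have h10 : 0 < `|h| + 1 by rewrite ltr_wpDl.
  apply/nbhs_ballP; exists (r / (`|h| + 1)); first by rewrite /= divr_gt0.
  move=> s; rewrite -ball_normE /ball_/= sub0r normrN => sr s0.
  have ns0 : 0 < `|s| by rewrite normr_gt0.
  have nsh : `|s *: h| = `|s| * `|h| by rewrite normrZ.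
  have := hr (s *: h) w; rewrite nsh => /(_ _)/wrap[].
    rewrite ltr_pdivlMr// in sr; apply: le_lt_trans sr.
    by rewrite ler_wpM2l// lerDl.
  have -> : u + t *: h + s *: h = u + (s + t) *: h.
    by rewrite -addrA -scalerDl [t + s]addrC.
  rewrite derivativeZ => hs.
  have -> : s *: (1 : R) = s by rewrite /GRing.scale/= mulr1.
  rewrite -(ler_pM2l ns0) -normrM.
  set a := A (u + (s + t) *: h) w - A (u + t *: h) w in hs *.
  have -> : s * (dA (u + t *: h) h w - s^-1 *: a) =
      - (a - s * dA (u + t *: h) h w).
    by rewrite /GRing.scale/=; field.
  rewrite normrN (le_trans hs)//.
  have -> : e / (`|h| * `|w| + 1) * (`|s| * `|h|) * `|w| =
     `|s| * (e * (`|h| * `|w| / (`|h| * `|w| + 1))).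
    by field; rewrite gt_eqF// ltr_wpDl// mulr_ge0.
  rewrite ler_wpM2l// ler_piMr ?(ltW e0)// ler_pdivrMr.
    by rewrite mul1r lerDl.
  by rewrite ltr_wpDl// mulr_ge0.
by apply: DeriveDef; [exact: cvgP key|exact: cvg_lim key].
Qed.

(** The error of the linearization of A about u is controlled by comparing, for
    a fixed test function w, the scalar function s |-> A (u + s rho) w with its
    tangent at 0: the Lipschitz bound on the derivative makes the difference,
    corrected by the quadratic term, nondecreasing.  Since rho solves the
    linearized equation on V, the linear part of the residual shrinks to its
    multiple by 1 - delta. *)
Lemma newton_residual_le V u rho (delta theta : R) : is_subspace V ->
    V rho -> (forall v, V v -> dA u rho v = F v - A u v) ->
    0 <= delta <= 1 -> 0 < theta -> Num.max `|u| `|rho| <= theta ->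
  residual_on A F V (u + delta *: rho) <=
    (1 - delta) * residual_on A F V u + M theta / 2 * delta ^+ 2 * `|rho| ^+ 2.
Proof.
move=> sV Vrho newt /andP[d0 d1] t0; rewrite ge_max => /andP[ut rhot].
have [_ _ [m m0 mM]] := lipdA; have M0 : 0 < M theta := lt_le_trans m0 (mM _ t0).
have r0 : 0 <= residual_on A F V u := residual_on_ge0 dA_ dF u sV.
apply: dual_norm_le => [|w Vw w1].
  apply: addr_ge0; first by rewrite mulr_ge0// subr_ge0.
  by rewrite !mulr_ge0 ?sqr_ge0// ltW.
pose f (s : R) := A (u + s *: rho) w - s * dA u rho w + M theta / 2 * `|rho| ^+ 2 * s ^+ 2.
pose f' (s : R) := dA (u + s *: rho) rho w - dA u rho w + M theta * `|rho| ^+ 2 * s.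
have df (s : R) : is_derive s (1 : R) f (f' s).
  have h1 := is_derive_along u rho w s.
  rewrite /f /f'; apply: is_derive_eq.
  by rewrite /GRing.scale/= ?mulr1; field.
have f'0 s : 0 <= s -> s <= 1 -> 0 <= f' s.
  move=> s0 s1; have usr : `|u - (u + s *: rho)| = s * `|rho|.
    by rewrite opprD addNKr normrN normrZ ger0_norm.
  have := @derivative_diff_le u (u + s *: rho) theta rho w t0.
  rewrite usr ge_max ut (le_trans _ rhot) ?ler_piMl// => /(_ erefl).
  by rewrite /f' w1 expr2; lra.
have cf : {within `[0, delta], continuous f}.
  by apply: derivable_within_continuous => s _; have [] := df s.
have [c] := @MVT_segment R f f' 0 delta d0 (fun s _ => df s) cf.
rewrite in_itv/= subr0 => /andP[c0 cd] fE.
have : f 0 <= f delta.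
  by rewrite -subr_ge0 fE mulr_ge0// f'0// (le_trans cd).
rewrite /f scale0r addr0 mul0r subr0 expr0n/= mulr0 addr0 newt// => h1.
have := le_dual_norm sV (in_dual_res dA_ dF u) Vw; rewrite w1 mulr1.
rewrite -/(residual_on A F V u) => h2.
have := ler_wpM2l (_ : 0 <= 1 - delta) h2; rewrite subr_ge0 => /(_ d1) h3.
lra.
Qed.

Lemma newton_update_le V u rho (c : R) : is_subspace V -> 0 < c ->
    V rho -> (forall v, V v -> dA u rho v = F v - A u v) ->
    c * `|rho| ^+ 2 <= dA u rho rho ->
  `|rho| <= c^-1 * residual_on A F V u.
Proof.
move=> sV c0 Vrho newt; rewrite newt// => h.
have h2 := le_dual_norm sV (in_dual_res dA_ dF u) Vrho.
have [->|rho0] := eqVneq rho 0.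
  rewrite normr0 mulr_ge0 ?invr_ge0 ?(ltW c0)//.
  exact: (residual_on_ge0 dA_ dF).
rewrite ler_pdivlMl// -(ler_pM2r (_ : 0 < `|rho|)) ?normr_gt0//.
by rewrite -mulrA -expr2 (le_trans h).
Qed.

End Newton.

(** * Damping and line search *)

Section Damping.
Context {R : realType}.

Lemma powR32 (x : R) : 0 < x -> x `^ (3 / 2) = x * Num.sqrt x.
Proof.
move=> x0; have -> : 3 / 2 = 1 + 2^-1 :> R by field.
by rewrite powRD ?gt_eqF ?implybT// powRr1 ?ltW// powR12_sqrt// ltW.
Qed.

Lemma reduction_factor_anti (x y : R) : 0 < x -> x <= y ->
  reduction_factor y <= reduction_factor x.
Proof.
move=> x0 xy; rewrite /reduction_factor lerB// ler_pM2r// ge0_ler_powR//.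
- by rewrite nnegrE ltW.
- by rewrite nnegrE (le_trans _ xy)// ltW.
Qed.

Lemma reduction_factor_itv (x : R) : 0 < x <= 1 -> 0 < reduction_factor x < 1.
Proof.
move=> /andP[x0 x1]; rewrite /reduction_factor powR32//.
have s0 : 0 < Num.sqrt x by rewrite sqrtr_gt0.
have s1 : Num.sqrt x <= 1 by rewrite -sqrtr1 ler_sqrt.
by apply/andP; split; nra.
Qed.

(** The threshold for the damping parameter is the square of the positive root
    of 2 C s^2 + s = 2, that is, exactly where the guaranteed residual reduction
    1 - delta + C delta^2 of a damped step meets 1 - delta^(3/2) / 2. *)
Lemma delta_starP (C x : R) : 0 < C -> 0 < x -> x <= delta_star C ->
  1 - x + C * x ^+ 2 <= reduction_factor x.
Proof.
move=> C0 x0; rewrite /delta_star le_min => /andP[xs _].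
rewrite /reduction_factor powR32//; set s := Num.sqrt x.
have s0 : 0 < s by rewrite sqrtr_gt0.
have xE : x = s ^+ 2 by rewrite sqr_sqrtr// ltW.
set K := Num.sqrt (16 * C + 1) in xs.
have K2 : K ^+ 2 = 16 * C + 1 by rewrite sqr_sqrtr; lra.
have K0 : 0 <= K by exact: sqrtr_ge0.
have K1 : 1 <= K by rewrite leNgt; apply/negP => K1; move: K2; rewrite expr2; nra.
have sK : 4 * C * s <= K - 1.
  rewrite -(@ler_pXn2r _ 2)// ?nnegrE; [|by rewrite !mulr_ge0// ltW|lra].
  move: xs; rewrite ler_pdivlMr ?mulr_gt0 ?exprn_gt0// xE => xs.
  by have -> : (4 * C * s) ^+ 2 = s ^+ 2 * (16 * C ^+ 2) by ring.
have Cs : 0 < C * s by rewrite mulr_gt0.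
have h : (4 * C * s + 1) ^+ 2 <= 16 * C + 1.
  by rewrite -K2 ler_pXn2r ?nnegrE//; lra.
have h1 : 2 * C * s ^+ 2 + s <= 2.
  by rewrite -(ler_pM2l (_ : 0 < 8 * C)) ?mulr_gt0//; lra.
have h2 : s ^+ 2 * (2 * C * s ^+ 2 + s) <= s ^+ 2 * 2.
  by rewrite ler_wpM2l ?sqr_ge0.
rewrite xE; lra.
Qed.

End Damping.

Section DampedNewton.
Context {R : realType} {X : completeNormedModType R}.
Context (A : X -> X -> R) (dA : X -> X -> X -> R) (F : X -> R).
Context (alpha beta c0 B0 : R) (L M : R -> R).
Hypotheses (dA_ : forall v, in_dual (A v)) (dF : in_dual F).
Hypothesis monA : strongly_monotone alpha A.
Hypothesis frA : frechet_derivative A dA.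
Hypothesis coA : uniformly_coercive beta dA.
Hypothesis lipdA : derivative_locally_lipschitz M dA.
Let Theta := (1 + c0) * B0.
Let Bbar0 := Bbar0_const alpha L c0 B0.
Let C0 := C0_const beta L M c0 B0 Bbar0.
Hypotheses (c0_gt0 : 0 < c0) (B0_gt0 : 0 < B0) (LTheta_gt0 : 0 < L Theta).

Lemma Bbar0E : Bbar0 = alpha^-1 * (L Theta * Theta) + B0.
Proof. by rewrite /Bbar0 /Bbar0_const /Theta; ring. Qed.

Lemma Theta_gt0 : 0 < Theta.
Proof. by rewrite mulr_gt0// addr_gt0. Qed.

Lemma Bbar0_gt0 : 0 < Bbar0.
Proof.
have [a0 _] := monA; rewrite Bbar0E addr_gt0// mulr_gt0 ?invr_gt0//.
by rewrite mulr_gt0// Theta_gt0.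
Qed.

Lemma C0_gt0 : 0 < C0.
Proof.
have [_ _ [m m0 mM]] := lipdA; have [b0 _] := coA.
have M0 : 0 < M Bbar0 := lt_le_trans m0 (mM _ Bbar0_gt0).
rewrite /C0 /C0_const divr_gt0 ?mulr_gt0 ?exprn_gt0//.
by rewrite addr_gt0.
Qed.

(** The update is bounded by the residual in two ways: with alpha to stay in the
    ball of radius Bbar0 where the derivative is Lipschitz, with beta to match
    the constant C0 in the quadratic term. *)
Lemma damped_newton_decrease V us u rho (delta : R) : is_subspace V ->
    galerkin_solution A F V us -> `|us| <= B0 -> V u ->
    residual_on A F V u <= L Theta * Theta ->
    V rho -> (forall v, V v -> dA u rho v = F v - A u v) ->
    0 < delta -> delta <= delta_star C0 ->
  residual_on A F V (u + delta *: rho) <=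
    reduction_factor delta * residual_on A F V u.
Proof.
move=> sV gus usB Vu rT Vrho newt d0 dd.
have [a0 _] := monA; have [b0 cob] := coA.
have r0 : 0 <= residual_on A F V u := residual_on_ge0 dA_ dF u sV.
have d1 : delta <= 1 by rewrite (le_trans dd)// /delta_star ge_min lexx orbT.
have arT : alpha^-1 * residual_on A F V u <= alpha^-1 * (L Theta * Theta).
  by rewrite ler_pM2l ?invr_gt0.
have uB : `|u| <= Bbar0.
  have := error_le_residual dA_ dF monA sV gus Vu => h.
  by rewrite -(subKr us u) (le_trans (ler_normB _ _))// Bbar0E addrC lerD// (le_trans h).
have rhoa := newton_update_le dA_ dF sV a0 Vrho newt (derivative_coercive dA_ monA frA u rho).
have rhob := newton_update_le dA_ dF sV b0 Vrho newt (cob u rho).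
have rhoB : `|rho| <= Bbar0 by rewrite (le_trans rhoa)// (le_trans arT)// Bbar0E lerDl ltW.
have umax : Num.max `|u| `|rho| <= Bbar0 by rewrite ge_max uB.
have d01 : 0 <= delta <= 1 by rewrite ltW.
apply: le_trans
  (newton_residual_le dA_ dF frA lipdA sV Vrho newt d01 Bbar0_gt0 umax) _.
have /(ler_wpM2r r0) := delta_starP C0_gt0 d0 dd; apply: le_trans.
rewrite [leRHS]mulrDl lerD2l.
have [_ _ [m m0 mM]] := lipdA.
have M0 : 0 < M Bbar0 := lt_le_trans m0 (mM _ Bbar0_gt0).
have rho2 : `|rho| ^+ 2 <= beta^-1 ^+ 2 * residual_on A F V u * (L Theta * Theta).
  rewrite (@le_trans _ _ ((beta^-1 * residual_on A F V u) ^+ 2))//.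
    by rewrite ler_pXn2r ?nnegrE// mulr_ge0 ?invr_ge0// ltW.
  by rewrite exprMn expr2 [X in _ * X]expr2 mulrA ler_wpM2l// mulr_ge0 ?mulr_ge0 ?invr_ge0// ltW.
have -> : C0 * delta ^+ 2 * residual_on A F V u = M Bbar0 / 2 * delta ^+ 2 *
    (beta^-1 ^+ 2 * residual_on A F V u * (L Theta * Theta)).
  by rewrite /C0 /C0_const /Theta; field; rewrite gt_eqF.
by rewrite ler_wpM2l// mulr_ge0 ?sqr_ge0// divr_ge0// ltW.
Qed.

End DampedNewton.

Section LineSearch.
Context {R : realType} {X : completeNormedModType R} (d : nat).
Context (VH : mesh R d -> set X) (A : X -> X -> R) (F : X -> R).

(** Once delta has been halved, dmin never exceeds it, so the acceptance
    threshold is at least as generous as the one guaranteed for delta; hence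
    the search stops at delta0 at the latest and dmin stays above delta0. *)
Lemma line_search_dmin TH u rho (delta dmin delta' dmin' delta0 : R) (i j : nat) :
    line_search VH A F TH u rho delta dmin delta' dmin' ->
    delta = 2 ^- i -> delta0 = 2 ^- j -> (0 < j)%N -> (i <= j)%N ->
    ((0 < i)%N -> dmin <= delta) -> delta0 <= dmin ->
    sufficient_decrease VH A F TH u rho delta0 delta0 ->
  delta0 <= dmin' /\ sufficient_decrease VH A F TH u rho delta' dmin'.
Proof.
move=> ls; elim: ls i => {delta dmin delta' dmin'} [//|].
move=> delta dmin delta' dmin' nsd _ IH i deltaE delta0E j0 ij idmin d0min sd0.
have ltij : (i < j)%N.
  rewrite ltn_neqAle ij andbT; apply/eqP => ijE; apply: nsd.
  have dd0 : delta = delta0 by rewrite deltaE delta0E ijE.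
  suff -> : dmin = delta0 by rewrite dd0.
  by apply/le_anti; rewrite d0min andbT -dd0 idmin// ijE.
apply: (IH i.+1) => //.
- by rewrite deltaE exprSr invfM.
- by move=> _; rewrite ge_min lexx.
- rewrite le_min d0min andbT delta0E deltaE -invfM -exprSr.
  by rewrite lef_pV2 ?posrE ?exprn_gt0// ler_eXn2l// ltr1n.
Qed.

End LineSearch.

(** * Summation lemmas *)

Section TailSums.
Context {R : realType}.
Implicit Types (y e c g : nat -> R).

(** The tail sums S of y decrease by y at each step, and y is at least S / C, so
    the tail sums contract by the factor 1 - 1 / C. *)
Lemma tail_sum_geometric y (C : R) N n : 1 <= C -> (n <= N)%N ->
    (forall m, 0 <= y m) ->
    (forall m, (n <= m <= N)%N -> \sum_(m <= i < N.+1) y i <= C * y m) ->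
  y N <= C * (1 - C^-1) ^+ (N - n) * y n.
Proof.
move=> C1 nN y0 yC; have C0 : 0 < C by exact: lt_le_trans C1.
have q0 : 0 <= 1 - C^-1 by rewrite subr_ge0 invf_le1.
pose S m := \sum_(m <= i < N.+1) y i.
have key k : (n + k <= N)%N -> S (n + k)%N <= (1 - C^-1) ^+ k * S n.
  elim: k => [|k IH] nkN; first by rewrite addn0 expr0 mul1r.
  have nk : (n + k <= N)%N by rewrite ltnW// -addnS.
  have SE : S (n + k)%N = y (n + k)%N + S (n + k.+1)%N.
    by rewrite /S big_ltn ?addnS// ltnS.
  have h := yC (n + k)%N; rewrite leq_addr nk -/(S _) in h.
  rewrite exprS -mulrA; apply: le_trans (ler_wpM2l q0 (IH nk)).
  move: (h isT); rewrite mulrC -ler_pdivrMr// mulrBl mul1r [_^-1 * _]mulrC.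
  by move: SE; lra.
have := key (N - n)%N; rewrite subnKC// => /(_ (leqnn _)).
rewrite {1}/S big_nat1 => h; apply: (le_trans h).
rewrite -mulrA mulrCA ler_wpM2l ?exprn_ge0//.
by apply: yC; rewrite leqnn.
Qed.

(** Sum the recursion and move rho times the sum to the left. *)
Lemma recursive_sum_le c g (rho : R) n N : rho < 1 -> (n <= N)%N ->
    (forall m, (n <= m < N)%N -> c m.+1 <= rho * c m + g m) ->
    0 <= rho * c N ->
  \sum_(n <= m < N.+1) c m <= (c n + \sum_(n <= m < N) g m) / (1 - rho).
Proof.
move=> r1 nN cg cN0; have r10 : 0 < 1 - rho by rewrite subr_gt0.
rewrite ler_pdivlMr//.
have : \sum_(n <= m < N) c m.+1 <= \sum_(n <= m < N) (rho * c m + g m).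
  by rewrite ler_sum_nat.
rewrite big_split/= -mulr_sumr.
have E1 : \sum_(n <= m < N.+1) c m = c n + \sum_(n <= m < N) c m.+1.
  by rewrite big_nat_recl.
have E2 : \sum_(n <= m < N.+1) c m = \sum_(n <= m < N) c m + c N.
  by rewrite big_nat_recr.
move: E1 E2; set S := \sum_(_ <= _ < N.+1) _; set S1 := \sum_(_ <= _ < _) c _.+1.
set S2 := \sum_(_ <= _ < _) c _; set G := \sum_(_ <= _ < _) g _.
move=> E1 E2 h; have : rho * S = rho * S2 + rho * c N by rewrite E2 mulrDr.
lra.
Qed.

(** Summing the recursion leaves the sum of the perturbations e, which is
    controlled by a small multiple of the sum of y itself; that multiple is
    absorbed. *)
Lemma perturbed_contraction_sum_le y e (q K eps B : R) l m :
    (l <= m)%N -> (forall j, 0 <= y j) -> 0 <= K -> q + K * eps < 1 ->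
    0 <= q + K * eps ->
    (forall j, (l <= j < m)%N -> y j.+1 <= q * y j + K * e j) ->
    \sum_(l <= j < m) e j <= eps * (\sum_(l <= j < m) y j) + B * y l ->
  \sum_(l <= j < m.+1) y j <= (1 + K * B) / (1 - (q + K * eps)) * y l.
Proof.
move=> lm y0 K0 r1 r0 ye eB; have r10 : 0 < 1 - (q + K * eps) by rewrite subr_gt0.
rewrite mulrAC ler_pdivlMr//.
have : \sum_(l <= j < m) y j.+1 <= \sum_(l <= j < m) (q * y j + K * e j).
  by rewrite ler_sum_nat.
rewrite big_split/= -!mulr_sumr.
have E1 : \sum_(l <= j < m.+1) y j = y l + \sum_(l <= j < m) y j.+1.
  by rewrite big_nat_recl.
have E2 : \sum_(l <= j < m.+1) y j = \sum_(l <= j < m) y j + y m.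
  by rewrite big_nat_recr.
move: E1 E2 eB; set S := \sum_(_ <= _ < m.+1) _; set S1 := \sum_(_ <= _ < _) y _.+1.
set S2 := \sum_(_ <= _ < _) y _; set G := \sum_(_ <= _ < _) e _.
move=> E1 E2 /(ler_wpM2l K0) eB h.
have h2 : (q + K * eps) * S2 <= (q + K * eps) * S.
  by rewrite ler_wpM2l// E2 lerDl.
lra.
Qed.

End TailSums.

(** * Enumeration of the steps of the algorithm *)

Section Trajectory.
Context (comp stop : nat -> nat -> Prop).
Hypothesis compS : forall l k, comp l k.+1 -> comp l k /\ ~ stop l k.
Hypothesis compL : forall l, comp l.+1 0 -> exists k, comp l k /\ stop l k.
Hypothesis stop0 : forall l, ~ stop l 0.
Implicit Types (lk : nat * nat) (l k : nat).

Definition active lk : Prop := comp lk.1 lk.2 /\ ~ stop lk.1 lk.2.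

(** The final iterate of a level is the initial one of the next, and only the
    latter is counted, hence the jump.  It is guarded by comp because stop may
    hold by accident at an index that was never computed. *)
Definition next_step lk : nat * nat :=
  if `[< comp lk.1 lk.2.+1 /\ stop lk.1 lk.2.+1 >] then (lk.1.+1, 0%N)
  else (lk.1, lk.2.+1).

Definition nth_step n : nat * nat := iter n next_step (0%N, 0%N).

Lemma comp_le l j k : (j <= k)%N -> comp l k -> comp l j.
Proof.
by move=> /subnKC <-; elim: (k - j)%N => [|i IH]; rewrite ?addn0// addnS => /compS[/IH].
Qed.

Lemma comp_before l j k : (j < k)%N -> comp l k -> ~ stop l j.
Proof. by move=> jk /(comp_le jk)/compS[]. Qed.

Lemma active_next lk : active (next_step lk) -> active lk.
Proof.
rewrite /next_step; case: ifPn => [/asboolP[/compS]//|_] [/= /compS]//.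
Qed.

Lemma active_nth_step n m : (m <= n)%N -> active (nth_step n) -> active (nth_step m).
Proof.
move=> /subnKC <-; elim: (n - m)%N => [|i IH]; rewrite ?addn0// addnS /=.
by move/active_next.
Qed.

(** By induction on the level: level l + 1 is entered from the step just before
    the one that stops level l, and that step exists since a level never stops
    at k = 0. *)
Lemma nth_step_surj lk : active lk -> exists n, lk = nth_step n.
Proof.
case: lk => l k; elim: l k => [|l IHl]; elim=> [|k IHk] [/= c s].
- by exists 0%N.
- have [n nE] : exists n, (0%N, k) = nth_step n by apply: IHk; exact: compS.
  exists n.+1; rewrite /= -/(nth_step n) -nE /next_step /=.
  by case: asboolP => // -[].
- have [[|k] [ck sk]] := compL c; first by have := stop0 sk.
  have [n nE] : exists n, (l, k) = nth_step n by apply: IHl; exact: compS.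
  exists n.+1; rewrite /= -/(nth_step n) -nE /next_step /=.
  by case: asboolP => // -[].
- have [n nE] : exists n, (l.+1, k) = nth_step n by apply: IHk; exact: compS.
  exists n.+1; rewrite /= -/(nth_step n) -nE /next_step /=.
  by case: asboolP => // -[].
Qed.

Lemma earlier_trans lk1 lk2 lk3 :
  earlier lk1 lk2 -> earlier lk2 lk3 -> earlier lk1 lk3.
Proof.
case: lk1 lk2 lk3 => [l1 k1] [l2 k2] [l3 k3]; rewrite /earlier /=; lia.
Qed.

Lemma earlier_irr lk : ~ earlier lk lk.
Proof. by case: lk => l k; rewrite /earlier /=; lia. Qed.

Lemma earlier_next lk : earlier lk (next_step lk).
Proof. by rewrite /next_step; case: ifP => _; rewrite /earlier /=; lia. Qed.

Lemma earlier_nth_step n m : (m < n)%N -> earlier (nth_step m) (nth_step n).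
Proof.
move=> /subnKC <-; elim: (n - m.+1)%N => [|i IH].
  by rewrite addn0; exact: earlier_next.
by rewrite addnS; apply: earlier_trans IH _; exact: earlier_next.
Qed.

Lemma nth_step_inj : injective nth_step.
Proof.
move=> m n mn; have [/earlier_nth_step|/earlier_nth_step|//] := ltngtP m n.
  by rewrite mn => /earlier_irr.
by rewrite mn => /earlier_irr.
Qed.

Lemma card_earlier n : active (nth_step n) ->
  #|` fset_set ([set lk | active lk] `&` [set lk | earlier lk (nth_step n)])|%fset = n.
Proof.
move=> an; have -> : [set lk | active lk] `&` [set lk | earlier lk (nth_step n)] =
    nth_step @` `I_n.
  apply/seteqP; split=> [lk [/= /nth_step_surj[m ->]] mn|_ [m /= mn <-]].
    exists m => //=; rewrite ltnNge leq_eqVlt; apply/negP => /orP[/eqP nm|/earlier_nth_step nm].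
      by move: mn; rewrite nm => /earlier_irr.
    exact: earlier_irr (earlier_trans nm mn).
  by split; [exact: active_nth_step (ltnW mn) an|exact: earlier_nth_step].
rewrite fset_set_image ?card_imfset//=; last exact: nth_step_inj.
rewrite fset_set_II card_imfset/=; last exact: val_inj.
exact: size_enum_ord.
Qed.

Lemma nth_step_cases m :
  nth_step m.+1 = ((nth_step m).1.+1, 0%N) \/
  nth_step m.+1 = ((nth_step m).1, (nth_step m).2.+1).
Proof. by rewrite /= -/(nth_step m) /next_step; case: ifP; [left|right]. Qed.

Lemma nth_step_le n m : (n <= m)%N -> ((nth_step n).1 < (nth_step m).1)%N \/
  (nth_step n).1 = (nth_step m).1 /\ ((nth_step n).2 <= (nth_step m).2)%N.
Proof.
rewrite leq_eqVlt => /orP[/eqP->|/earlier_nth_step]; first by right.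
by case=> [?|[? /ltnW ?]]; [left|right].
Qed.

Lemma nth_step_level_le n m : (n <= m)%N -> ((nth_step n).1 <= (nth_step m).1)%N.
Proof. by case/nth_step_le => [/ltnW//|[-> _]]. Qed.

End Trajectory.
Arguments nth_step : simpl never.

(** * The index set of the algorithm *)

Section Execution.
Context {R : realType} {X : completeNormedModType R} (d : nat).
Context (VH : mesh R d -> set X).
Context (A : X -> X -> R) (dA : X -> X -> X -> R) (F : X -> R).
Context (eta : mesh R d -> simplex R d -> X -> R).
Context (lam : R) (kmin : nat) (tr : trace X d).
Hypothesis kmin_gt0 : (0 < kmin)%N.

Let comp := computed VH A dA F eta lam kmin tr.
Let stop l k := stopping VH A F eta lam kmin (tr_mesh tr l) k (tr_u tr l k).

Lemma not_stop0 l : ~ stop l 0.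
Proof. by case; rewrite leqNgt kmin_gt0. Qed.

Lemma computedS_inv l k : comp l k.+1 -> comp l k /\ ~ stop l k.
Proof. by move=> H; inversion H. Qed.

Lemma computed_level_inv l : comp l.+1 0 -> exists k, comp l k /\ stop l k.
Proof. by move=> H; inversion H; exists k. Qed.

Lemma computed_level l k : comp l k -> stop l k -> comp l.+1 0.
Proof. exact: computed_refine. Qed.

(** The criterion ends the loop of its level and opens the next one, so the final
    indices of the completed levels are exactly the computed ones at which it
    holds. *)
Lemma Qset_active : Qset VH A dA F eta lam kmin tr = [set lk | active comp stop lk].
Proof.
apply/seteqP; split=> -[l k] /= [c nk].
  split=> //= st; apply: nk; split; last exact: computed_level c st.
  split=> // k' ck'; rewrite leqNgt; apply/negP => kk'.
  exact: (comp_before computedS_inv kk' ck').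
split=> // -[[_ kmax] /computed_level_inv[j [cj sj]]].
apply: nk; suff -> : k = j by [].
apply/eqP; rewrite eqn_leq kmax// andbT leqNgt; apply/negP => jk.
exact: (comp_before computedS_inv jk c).
Qed.

Lemma step_counter_nth n : active comp stop (nth_step comp stop n) ->
  step_counter VH A dA F eta lam kmin tr (nth_step comp stop n) = n.
Proof.
move=> an; rewrite /step_counter Qset_active.
have h := card_earlier computedS_inv computed_level_inv not_stop0 an.
exact: h.
Qed.

End Execution.

(** * Estimator reduction *)

Section EstimatorReduction.
Context {R : realType} {X : completeNormedModType R} (d : nat).
Context (VH : mesh R d -> set X) (T0 : mesh R d).
Context (eta : mesh R d -> simplex R d -> X -> R) (Cstab : R -> R) (qred theta : R).
Implicit Types (TH Th U W MH : mesh R d) (v w : X).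

Lemma eta_on_sqr TH U v : eta_on eta TH U v ^+ 2 = \sum_(T <- U) eta TH T v ^+ 2.
Proof. by rewrite sqr_sqrtr// sumr_ge0// => T _; exact: sqr_ge0. Qed.

Lemma eta_on_ge0 TH U v : 0 <= eta_on eta TH U v.
Proof. exact: sqrtr_ge0. Qed.

Lemma eta_on_split TH U W v : eta_on eta TH U v ^+ 2 =
  eta_on eta TH (U `&` W)%fset v ^+ 2 + eta_on eta TH (U `\` W)%fset v ^+ 2.
Proof.
rewrite !eta_on_sqr (bigID (fun T => T \in W))/=; congr (_ + _).
all: rewrite -big_filter; apply: perm_big; apply: uniq_perm => [||T].
all: try by rewrite ?filter_uniq ?fset_uniq.
all: by rewrite mem_filter !inE // andbC.
Qed.

Hypothesis VHnest : forall TH Th, refinement T0 TH -> refinement TH Th ->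
  VH TH `<=` VH Th.
Hypothesis stabE : stability VH T0 eta Cstab.
Hypothesis redE : reduction VH T0 eta qred.

(** Stability with equal arguments says that the contributions of the common
    elements coincide. *)
Lemma eta_on_common TH Th v : refinement T0 TH -> refinement TH Th -> VH TH v ->
  eta_on eta Th (Th `&` TH)%fset v = eta_on eta TH (Th `&` TH)%fset v.
Proof.
move=> rT rh Vv; have t0 : 0 < `|v| + 1 by rewrite ltr_wpDl.
have [_ /(_ _ _ rT rh (Th `&` TH)%fset v v)] := stabE t0.
rewrite subrr normr0 mulr0 ge_max lerDl ler01 (ltW t0).
move=> /(_ (fsubset_refl _) (VHnest rT rh Vv) Vv isT).
by rewrite normr_le0 subr_eq0 => /eqP.
Qed.

Lemma eta_refine_le TH Th v : refinement T0 TH -> refinement TH Th -> VH TH v ->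
  eta_tot eta Th v ^+ 2 <= eta_tot eta TH v ^+ 2 -
    (1 - qred ^+ 2) * eta_on eta TH (TH `\` Th)%fset v ^+ 2.
Proof.
move=> rT rh Vv; have [/andP[q0 _] red] := redE.
rewrite /eta_tot (eta_on_split Th Th TH) (eta_on_split TH TH Th).
rewrite eta_on_common// [(TH `&` Th)%fset]fsetIC.
have := red _ _ rT rh _ Vv; rewrite -(@ler_pXn2r _ 2)// ?nnegrE ?eta_on_ge0//.
  by rewrite exprMn; lra.
by rewrite mulr_ge0 ?eta_on_ge0// ltW.
Qed.

Lemma eta_refine_mono TH Th v : refinement T0 TH -> refinement TH Th -> VH TH v ->
  eta_tot eta Th v <= eta_tot eta TH v.
Proof.
move=> rT rh Vv; rewrite -(@ler_pXn2r _ 2)// ?nnegrE ?eta_on_ge0//.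
apply: (le_trans (eta_refine_le rT rh Vv)); have [/andP[q0 q1] _] := redE.
rewrite gerBl mulr_ge0 ?sqr_ge0// subr_ge0 exprn_ile1// ltW//.
Qed.

Lemma eta_marked_le TH Th MH v : (MH `<=` TH)%fset -> [disjoint MH & Th]%fset ->
  eta_on eta TH MH v ^+ 2 <= eta_on eta TH (TH `\` Th)%fset v ^+ 2.
Proof.
move=> MT MTh; rewrite (eta_on_split TH (TH `\` Th)%fset MH).
have -> : ((TH `\` Th) `&` MH)%fset = MH; last by rewrite lerDl sqr_ge0.
apply/fsetP => T; rewrite !inE andbC; case: (boolP (T \in MH)) => //= TM.
by rewrite (fsubsetP MT)// andbT; exact: (fdisjointP MTh).
Qed.

(** Marked elements are refined, the refined ones contribute at most qred times
    their former share, and this share is at least theta by marking. *)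
Lemma doerfler_reduction TH Th MH v : refinement T0 TH -> refinement TH Th ->
    VH TH v -> doerfler eta theta TH v MH -> [disjoint MH & Th]%fset ->
  eta_tot eta Th v ^+ 2 <= (1 - (1 - qred ^+ 2) * theta) * eta_tot eta TH v ^+ 2.
Proof.
move=> rT rh Vv [MT dM] MTh; apply: (le_trans (eta_refine_le rT rh Vv)).
have [/andP[q0 q1] _] := redE.
have h : 0 <= 1 - qred ^+ 2 by rewrite subr_ge0 exprn_ile1// ltW.
have := ler_wpM2l h (le_trans dM (eta_marked_le v MT MTh)); lra.
Qed.

Lemma eta_tot_stable TH v w (r : R) : 0 < r -> refinement T0 TH -> conforming TH ->
    VH TH v -> VH TH w -> `|v| <= r -> `|w| <= r ->
  eta_tot eta TH v <= eta_tot eta TH w + Cstab (2 * r) * `|v - w|.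
Proof.
move=> r0 rT cT Vv Vw vr wr; have r20 : 0 < 2 * r by rewrite mulr_gt0.
have [_ /(_ _ _ rT (refinement_refl cT) TH v w)] := stabE r20.
rewrite fsetIid fsubset_refl ge_max => /(_ isT Vv Vw).
have -> : `|v| <= 2 * r by lra.
have -> : `|v - w| <= 2 * r by rewrite (le_trans (ler_normB _ _))//; lra.
by move=> /(_ isT)/(le_trans (ler_norm _)); rewrite /eta_tot; lra.
Qed.

End EstimatorReduction.

(** * From summability over the levels to linear convergence over all steps *)

Section FullLinearConvergence.
Context {R : realType}.
Context (comp stop : nat -> nat -> Prop).
Hypothesis compS : forall l k, comp l k.+1 -> comp l k /\ ~ stop l k.
Hypothesis compL : forall l, comp l.+1 0 -> exists k, comp l k /\ stop l k.
Let s := nth_step comp stop.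

Lemma comp_level_le l l' : (l' <= l)%N -> comp l 0 -> comp l' 0.
Proof.
move=> /subnKC <-; elim: (l - l')%N => [|i IH]; rewrite ?addn0// addnS.
by move=> /compL[k [/(comp_le compS (leq0n k))/IH]].
Qed.

Context (H : nat * nat -> R) (x : nat -> R) (rbar C2 C3 C4 C5 : R).
Hypothesis rbar01 : 0 < rbar < 1.
Hypotheses (C2_ge0 : 0 <= C2) (C4_ge0 : 0 <= C4) (C5_ge0 : 0 <= C5).
Hypothesis H_ge0 : forall lk, comp lk.1 lk.2 -> 0 <= H lk.
Hypothesis x_ge0 : forall l, 0 <= x l.
Hypothesis H_in_level : forall l j k, active comp stop (l, k) -> (j <= k)%N ->
  H (l, k) <= C2 * rbar ^+ (k - j) * H (l, j).
Hypothesis H_next_level : forall l, comp l.+1 0 -> H (l.+1, 0%N) <= C3 * x l.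
Hypothesis x_le_H : forall l j, comp l.+1 0 -> comp l j -> x l <= C4 * H (l, j).
Hypothesis x_tail : forall l m, (l <= m)%N -> comp m.+1 0 ->
  \sum_(l <= j < m.+1) x j ^+ 2 <= C5 * x l ^+ 2.

(** Bounds the tail sums of the squared quasi-error: the in-level geometric series
    gives 1 / (1 - rbar^2), the levels give C5 C4^2.  The summand 2 keeps
    1 - 1 / tail_const, the square of the rate, positive. *)
Definition tail_const : R :=
  2 + C2 ^+ 2 * (1 + C3 ^+ 2) * (1 + C5 * C4 ^+ 2) / (1 - rbar ^+ 2).

Lemma tail_const_ge2 : 2 <= tail_const.
Proof.
have [r0 r1] := andP rbar01; rewrite lerDl divr_ge0//; last first.
  by rewrite subr_ge0 exprn_ile1// ltW.
have C32 : 0 <= 1 + C3 ^+ 2 by rewrite addr_ge0 ?sqr_ge0.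
have C54 : 0 <= 1 + C5 * C4 ^+ 2 by rewrite addr_ge0 ?mulr_ge0 ?sqr_ge0.
by rewrite mulr_ge0// mulr_ge0// sqr_ge0.
Qed.

(** Along the enumeration of the steps, the squared quasi-error is dominated by a
    sequence c that decays geometrically inside a level and is reset to the
    square of the level quantity x at each change of level; its sum is therefore
    governed by the sum over the levels visited. *)
Lemma quasi_error_tail_sum n N : (n <= N)%N -> active comp stop (s N) ->
  \sum_(n <= m < N.+1) H (s m) ^+ 2 <= tail_const * H (s n) ^+ 2.
Proof.
move=> nN aN; have [r0 r1] := andP rbar01.
pose rho := rbar ^+ 2.
have rho0 : 0 < rho by rewrite exprn_gt0.
have rk0 k : 0 <= rho ^+ k by rewrite exprn_ge0// ltW.
have sqE i h : (C2 * rbar ^+ i * h) ^+ 2 = C2 ^+ 2 * (rho ^+ i * h ^+ 2).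
  have -> : rho ^+ i = (rbar ^+ i) ^+ 2 by rewrite /rho -!exprM mulnC.
  by ring.
have rho1 : rho < 1 by rewrite exprn_ilt1// ltW.
have am m : (m <= N)%N -> active comp stop (s m).
  by move=> mN; exact: active_nth_step mN aN.
set f0 := H (s n) ^+ 2; have f00 : 0 <= f0 by exact: sqr_ge0.
pose g m := if (s m.+1).1 == (s m).1 then 0 else x (s m).1 ^+ 2.
pose c m := if (s m).1 == (s n).1 then rho ^+ ((s m).2 - (s n).2) * f0
            else rho ^+ (s m).2 * x (s m).1.-1 ^+ 2.
have c0 m : 0 <= c m.
  by rewrite /c; case: ifP => _; rewrite mulr_ge0 ?rk0 ?sqr_ge0.
have cg m : (n <= m < N)%N -> c m.+1 <= rho * c m + g m.
  case/andP=> nm mN; have lnm := nth_step_level_le comp stop nm.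
  rewrite /g; have [E|E] := nth_step_cases comp stop m; rewrite -/s in E.
    rewrite E /= gtn_eqF// [c m.+1]/c E /= gtn_eqF// expr0 mul1r lerDr.
    by rewrite mulr_ge0 ?c0// ltW.
  rewrite E /= eqxx addr0 /c E /=; case: eqP => [lE|_]; last by rewrite exprS mulrA.
  have [|[_ le2]] := nth_step_le comp stop nm; first by rewrite -/s lE ltnn.
  by rewrite subSn// exprS mulrA.
have gE M : (n <= M)%N -> \sum_(n <= m < M) g m =
    \sum_((s n).1 <= j < (s M).1) x j ^+ 2.
  elim: M => [|M IH] nM.
    by move: nM; rewrite leqn0 => /eqP ->; rewrite !big_geq.
  move: nM; rewrite leq_eqVlt => /orP[/eqP <-|]; first by rewrite !big_geq.
  rewrite ltnS => nM; rewrite big_nat_recr//= IH// /g.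
  have lnM := nth_step_level_le comp stop nM.
  have [E|E] := nth_step_cases comp stop M; rewrite -/s in E; rewrite E /=.
    by rewrite gtn_eqF// big_nat_recr.
  by rewrite eqxx addr0.
have fc m : (n <= m <= N)%N ->
    H (s m) ^+ 2 <= C2 ^+ 2 * (1 + C3 ^+ 2) * c m.
  case/andP=> nm mN; have := am m mN; have := nth_step_le comp stop nm; rewrite -/s /c.
  case: (s m) => l k /=; rewrite /f0; case En: (s n) => [l0 k0] /=.
  have cn : comp l0 k0 by have [] := am n nN; rewrite En.
  move=> lk alk; have Hlk0 : 0 <= H (l, k) by apply: H_ge0; case: alk.
  have C22 : 0 <= C2 ^+ 2 by exact: sqr_ge0.
  case: eqP => [ll0|nll0].
    have kk0 : (k0 <= k)%N by case: lk => [|[]//]; rewrite ll0 ltnn.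
    have h := H_in_level alk kk0; rewrite ll0 in Hlk0 h *.
    have H00 : 0 <= H (l0, k0) by exact: H_ge0.
    apply: (@le_trans _ _ ((C2 * rbar ^+ (k - k0) * H (l0, k0)) ^+ 2)).
      by rewrite ler_pXn2r ?nnegrE// (le_trans Hlk0).
    rewrite sqE -[leRHS]mulrA ler_wpM2l// ler_peMl ?lerDl ?sqr_ge0//.
    by rewrite mulr_ge0 ?sqr_ge0 ?rk0.
  case: l => [|l] in lk alk Hlk0 nll0 *.
    by case: lk => [//|[l00 _]]; case: nll0.
  have cl : comp l.+1 0 by have [/= ck _] := alk; exact: (comp_le compS (leq0n k) ck).
  have h := H_in_level alk (leq0n k); rewrite subn0 in h.
  have h2 := H_next_level cl.
  have h3 : H (l.+1, k) <= C2 * rbar ^+ k * (C3 * x l).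
    by rewrite (le_trans h)// ler_wpM2l// mulr_ge0// exprn_ge0// ltW.
  apply: (@le_trans _ _ ((C2 * rbar ^+ k * (C3 * x l)) ^+ 2)).
    by rewrite ler_pXn2r ?nnegrE// (le_trans Hlk0).
  have := mulr_ge0 C22 (mulr_ge0 (rk0 k) (sqr_ge0 (x l))).
  by rewrite sqE exprMn /=; lra.
have CC0 : 0 <= C5 * C4 ^+ 2 * f0 by rewrite mulr_ge0// mulr_ge0// sqr_ge0.
have gs : \sum_(n <= m < N) g m <= C5 * C4 ^+ 2 * f0.
  rewrite gE//; have := nth_step_le comp stop nN; rewrite -/s; have [cN _] := am N (leqnn N).
  have [cn _] := am n nN; case: (s N) cN => l k /= cN.
  case: l cN => [|l] cN lN.
    by rewrite big_geq.
  have [lel|lel] := leqP (s n).1 l; last first.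
    by rewrite big_geq.
  have cl : comp l.+1 0 by exact: (comp_le compS (leq0n k) cN).
  apply: (le_trans (x_tail lel cl)); rewrite -mulrA ler_wpM2l//.
  have cl0 : comp (s n).1.+1 0 by exact: comp_level_le cl.
  rewrite /f0 -exprMn ler_pXn2r ?nnegrE ?x_ge0//.
    by have := x_le_H cl0 cn; rewrite -surjective_pairing.
  by rewrite mulr_ge0// H_ge0.
apply: (@le_trans _ _ (C2 ^+ 2 * (1 + C3 ^+ 2) * \sum_(n <= m < N.+1) c m)).
  rewrite mulr_sumr ler_sum_nat// => m; rewrite ltnS; exact: fc.
have D0 : 0 <= C2 ^+ 2 * (1 + C3 ^+ 2).
  by rewrite mulr_ge0 ?addr_ge0 ?sqr_ge0.
have rc0 : 0 <= rho * c N by rewrite mulr_ge0// ltW.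
apply: (le_trans (ler_wpM2l D0 (recursive_sum_le rho1 nN cg rc0))).
have -> : c n = f0 by rewrite /c eqxx subnn expr0 mul1r.
have h1 : (f0 + \sum_(n <= m < N) g m) / (1 - rho) <=
    (1 + C5 * C4 ^+ 2) * f0 / (1 - rho).
  by rewrite ler_pM2r ?invr_gt0 ?subr_gt0//; lra.
apply: (le_trans (ler_wpM2l D0 h1)).
rewrite /tail_const -/rho [leRHS]mulrDl.
have -> : C2 ^+ 2 * (1 + C3 ^+ 2) * ((1 + C5 * C4 ^+ 2) * f0 / (1 - rho)) =
  C2 ^+ 2 * (1 + C3 ^+ 2) * (1 + C5 * C4 ^+ 2) / (1 - rho) * f0.
  by rewrite -[_ * f0 / _]mulrAC !mulrA.
by rewrite lerDr mulr_ge0.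
Qed.

Definition conv_rate : R := Num.sqrt (1 - tail_const^-1).

Lemma conv_rate_itv : 0 < conv_rate < 1.
Proof.
have t2 := tail_const_ge2; have t0 : 0 < tail_const by exact: lt_le_trans t2.
have ti : 0 < tail_const^-1 by rewrite invr_gt0.
have ti1 : tail_const^-1 < 1 by rewrite invf_lt1// (lt_le_trans _ t2)// ltr1n.
rewrite sqrtr_gt0 subr_gt0 ti1 /= -sqrtr1 ltr_sqrt//; lra.
Qed.

Lemma full_linear_convergence n N : (n <= N)%N -> active comp stop (s N) ->
  H (s N) <= Num.sqrt tail_const * conv_rate ^+ (N - n) * H (s n).
Proof.
move=> nN aN; have t2 := tail_const_ge2.
have t0 : 0 < tail_const by exact: lt_le_trans t2.
have t1 : 1 <= tail_const by rewrite (le_trans _ t2)// ler1n.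
have Hs m : (m <= N)%N -> 0 <= H (s m).
  by move=> mN; apply: H_ge0; have [] := active_nth_step compS mN aN.
have q0 : 0 <= 1 - tail_const^-1 by rewrite subr_ge0 invf_le1.
rewrite -(@ler_pXn2r _ 2)// ?nnegrE ?Hs//; last first.
  by rewrite !mulr_ge0 ?exprn_ge0 ?sqrtr_ge0 ?Hs.
have -> : (Num.sqrt tail_const * conv_rate ^+ (N - n) * H (s n)) ^+ 2 =
    tail_const * (1 - tail_const^-1) ^+ (N - n) * H (s n) ^+ 2.
  have <- : conv_rate ^+ 2 = 1 - tail_const^-1 by exact: sqr_sqrtr.
  rewrite -{2}(sqr_sqrtr (ltW t0)) -(exprM conv_rate) mulnC exprM; ring.
apply: (@tail_sum_geometric _ (fun m => H (s m) ^+ 2)) => // [m|m /andP[_ mN]].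
  exact: sqr_ge0.
exact: quasi_error_tail_sum.
Qed.

End FullLinearConvergence.

(** * The constants *)

Section Rates.
Context {R : realType}.
Context (alpha q0 qred rbar0 Cst theta lam : R) (kmin : nat) (Corth : R).

(** The weight of the estimator against the error in the level quantity
    e + weight * h: the error enters the estimator recursion with the factor
    2 Cst, so that this choice turns q0 into (1 + q0) / 2 < 1. *)
Definition weight : R := (1 - q0) / (4 * Cst).
Definition marking_factor : R := Num.sqrt (1 - (1 - qred ^+ 2) * theta).
Definition level_factor : R := Num.max ((1 + q0) / 2) marking_factor.
(** Bounds the estimator at the Galerkin solution by the level quantity. *)
Definition level_stability : R := Cst + weight^-1.
Definition orth_eps : R :=
  Num.min 2^-1 ((1 - level_factor) ^+ 2 / (2 * level_stability ^+ 2)).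

(** Bounds the quasi-error by that of any earlier iterate of the same level. *)
Definition restart_const : R := 1 + 2 * Cst / alpha.
Definition in_level_const : R := restart_const / rbar0 ^+ kmin + 1 + lam^-1.
Definition next_level_const : R :=
  q0 * alpha / rbar0 ^+ kmin * (1 + (1 + Corth) * level_stability) + weight^-1.
Definition level_end_const : R := (alpha^-1 + weight) * restart_const.
Definition level_tail_const : R :=
  (1 + (1 - level_factor)^-1 * (Corth * level_stability ^+ 2)) /
  (1 - (level_factor + (1 - level_factor)^-1 * (orth_eps * level_stability ^+ 2))).
Definition total_const : R := tail_const rbar0 in_level_const next_level_const
  level_end_const level_tail_const.
Definition total_rate : R := conv_rate rbar0 in_level_const next_level_const
  level_end_const level_tail_const.

Definition admissible : Prop :=
  [/\ 0 < alpha, 0 < q0 < 1, 0 < qred < 1 & 0 < rbar0 < 1] /\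
  [/\ 0 < Cst, 0 < theta <= 1 & 0 < lam].
Hypothesis adm : admissible.

Lemma q0_itv : 0 < q0 < 1. Proof. by case: adm => -[]. Qed.

Lemma Cst_gt0 : 0 < Cst. Proof. by case: adm => _ []. Qed.

Lemma weight_gt0 : 0 < weight.
Proof.
have [_ q1] := andP q0_itv.
by rewrite divr_gt0 ?subr_gt0// mulr_gt0// Cst_gt0.
Qed.

Lemma marking_factor_itv : 0 <= marking_factor < 1.
Proof.
have [[_ _ /andP[r0 r1] _] [_ /andP[t0 t1] _]] := adm.
rewrite sqrtr_ge0 /= -sqrtr1 ltr_sqrt// ltrBlDr ltrDl mulr_gt0//.
by rewrite subr_gt0 exprn_ilt1// ltW.
Qed.

Lemma level_factor_itv : 0 <= level_factor < 1.
Proof.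
have [m0 m1] := andP marking_factor_itv; have [r0 r1] := andP q0_itv.
by rewrite /level_factor le_max m0 orbT gt_max m1 andbT; lra.
Qed.

Lemma level_stability_gt0 : 0 < level_stability.
Proof. by rewrite addr_gt0 ?Cst_gt0// invr_gt0 weight_gt0. Qed.

Lemma orth_eps_itv : 0 < orth_eps < 1.
Proof.
have [m0 m1] := andP level_factor_itv.
rewrite /orth_eps lt_min gt_min invr_gt0 ltr0n /=.
rewrite divr_gt0 ?exprn_gt0 ?subr_gt0 ?mulr_gt0 ?exprn_gt0 ?level_stability_gt0//=.
by rewrite invf_lt1 ?ltr1n.
Qed.

(** The parameter of quasi-orthogonality is small enough for the estimator
    terms to be absorbed by half of the gap between the level factor and 1. *)
Lemma level_factor_absorb : level_factor +
  (1 - level_factor)^-1 * (orth_eps * level_stability ^+ 2) < 1.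
Proof.
have [m0 m1] := andP level_factor_itv; have S0 := level_stability_gt0.
have p0 : 0 < 1 - level_factor by rewrite subr_gt0.
have h : orth_eps * level_stability ^+ 2 <= (1 - level_factor) ^+ 2 / 2.
  rewrite -ler_pdivlMr ?exprn_gt0// -mulrA -invfM.
  by rewrite /orth_eps ge_min lexx orbT.
have := ler_wpM2l (ltW (_ : 0 < (1 - level_factor)^-1)) h.
rewrite invr_gt0 => /(_ p0).
have -> : (1 - level_factor)^-1 * ((1 - level_factor) ^+ 2 / 2) = (1 - level_factor) / 2.
  by field; rewrite gt_eqF.
lra.
Qed.

Hypothesis Corth_gt0 : 0 < Corth.

Lemma restart_const_gt0 : 0 < restart_const.
Proof.
have [[a0 _ _ _] _] := adm.
by rewrite addr_gt0// divr_gt0// mulr_gt0// Cst_gt0.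
Qed.

Lemma in_level_const_ge0 : 0 <= in_level_const.
Proof.
have [[_ _ _ /andP[r0 _]] [_ _ l0]] := adm.
rewrite /in_level_const !addr_ge0// ?invr_ge0 ?(ltW l0)//.
by rewrite divr_ge0 ?exprn_ge0 ?(ltW r0) ?(ltW restart_const_gt0).
Qed.

Lemma level_end_const_ge0 : 0 <= level_end_const.
Proof.
have [[a0 _ _ _] _] := adm; have w0 := weight_gt0.
by rewrite mulr_ge0 ?(ltW restart_const_gt0)// addr_ge0 ?invr_ge0 ?ltW.
Qed.

Lemma level_tail_const_ge0 : 0 <= level_tail_const.
Proof.
have [m0 m1] := andP level_factor_itv.
rewrite divr_ge0 ?subr_ge0 ?(ltW level_factor_absorb)//.
rewrite addr_ge0// mulr_ge0 ?invr_ge0 ?subr_ge0 ?(ltW m1)//.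
by rewrite mulr_ge0 ?sqr_ge0// ltW.
Qed.

Lemma total_rate_itv : 0 < total_rate < 1.
Proof.
have [[_ _ _ r01] _] := adm.
by apply: conv_rate_itv r01 level_end_const_ge0 level_tail_const_ge0.
Qed.

Lemma total_const_gt0 : 0 < total_const.
Proof.
have [[_ _ _ r01] _] := adm.
by rewrite (lt_le_trans _ (tail_const_ge2 _ _ r01 level_end_const_ge0 level_tail_const_ge0)).
Qed.

End Rates.

(** * The recursion for the quasi-error *)

Section QuasiErrorRecursion.
Context {R : realType}.
Context (alpha q0 qred rbar0 Cst theta lam : R) (kmin : nat) (Corth : R).
Hypothesis adm : admissible alpha q0 qred rbar0 Cst theta lam.
Hypothesis Corth_gt0 : 0 < Corth.
Context (comp stop : nat -> nat -> Prop).
Hypothesis compS : forall l k, comp l k.+1 -> comp l k /\ ~ stop l k.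
Hypothesis compL : forall l, comp l.+1 0 -> exists k, comp l k /\ stop l k.

(** The argument only sees numbers: r l k and eta l k are the residual and the
    estimator of the iterate (l, k), e l and h l the error and the estimator of
    the final iterate of level l, dist l the distance between the Galerkin
    solutions of the levels l and l + 1, and b l the estimator at the Galerkin
    solution of level l. *)
Context (r eta : nat -> nat -> R) (e h dist b : nat -> R).
Hypothesis r_ge0 : forall l k, comp l k -> 0 <= r l k.
Hypothesis eta_ge0 : forall l k, 0 <= eta l k.
Hypothesis e_ge0 : forall l, 0 <= e l.
Hypothesis h_ge0 : forall l, 0 <= h l.
Hypothesis dist_ge0 : forall l, 0 <= dist l.
Hypothesis b_ge0 : forall l, 0 <= b l.
Hypothesis r_contr : forall l k, comp l k.+1 -> r l k.+1 <= rbar0 * r l k.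
Hypothesis eta_stable : forall l j k, comp l j -> comp l k ->
  eta l k <= eta l j + Cst / alpha * (r l k + r l j).
Hypothesis not_stop : forall l k, comp l k -> ~ stop l k -> (kmin <= k)%N ->
  lam * eta l k <= r l k.
Hypothesis level_end : forall l k, comp l k -> stop l k ->
  h l = eta l k /\ e l <= alpha^-1 * r l k.
Hypothesis level_start : forall l, comp l.+1 0 ->
  r l.+1 0 <= q0 * alpha / rbar0 ^+ kmin * (dist l + e l) /\ eta l.+1 0 <= h l.
Hypothesis level_error : forall l, comp l.+2 0 -> e l.+1 <= q0 * (e l + dist l).
Hypothesis level_estimator : forall l, comp l.+2 0 ->
  h l.+1 <= marking_factor qred theta * h l + 2 * Cst * (e l + dist l).
Hypothesis galerkin_estimator : forall l, comp l.+1 0 -> b l <= h l + Cst * e l.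
Let eps := orth_eps q0 qred Cst theta.
Hypothesis quasi_orth : forall l n, comp (l + n).+1 0 ->
  \sum_(l <= i < (l + n).+1) (dist i ^+ 2 - eps * b i ^+ 2) <= Corth * b l ^+ 2.

Let w := weight q0 Cst.
Let S := level_stability q0 Cst.
Let q := level_factor q0 qred theta.
Let C1 := restart_const alpha Cst.
Let x l := e l + w * h l.
Let H (lk : nat * nat) := r lk.1 lk.2 + eta lk.1 lk.2.

Lemma quasi_error_ge0 lk : comp lk.1 lk.2 -> 0 <= H lk.
Proof. by move=> c; rewrite addr_ge0 ?r_ge0. Qed.

Lemma level_quantity_ge0 l : 0 <= x l.
Proof. by rewrite addr_ge0// mulr_ge0// ltW// (weight_gt0 adm). Qed.

Lemma residual_geometric l j k : comp l k -> (j <= k)%N ->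
  r l k <= rbar0 ^+ (k - j) * r l j.
Proof.
have [[_ _ _ /andP[r0 _]] _] := adm.
move=> + /subnKC jk; rewrite -jk; elim: (k - j)%N => [|i IH].
  by rewrite addn0 subnn expr0 mul1r.
rewrite addnS subSn ?leq_addr// => c; apply: (le_trans (r_contr c)).
by rewrite exprS -mulrA ler_wpM2l ?(ltW r0)// IH//; have [] := compS c.
Qed.

Lemma residual_noninc l j k : comp l k -> (j <= k)%N -> r l k <= r l j.
Proof.
move=> c jk; have [[_ _ _ /andP[r0 r1]] _] := adm.
apply: (le_trans (residual_geometric c jk)).
by rewrite ler_piMl ?r_ge0 ?exprn_ile1 ?ltW//; exact: (comp_le compS jk c).
Qed.

(** Within a level the residual decreases, and by stability the estimator varies
    by at most a multiple of the residuals. *)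
Lemma quasi_error_restart l j k : comp l k -> (j <= k)%N -> H (l, k) <= C1 * H (l, j).
Proof.
move=> c jk; have [[a0 _ _ _] [C0 _ _]] := adm.
have cj : comp l j by exact: (comp_le compS jk c).
have rr := residual_noninc c jk; have e1 := eta_stable cj c.
have rj := r_ge0 cj; have ej := eta_ge0 l j.
have Ca : 0 < Cst / alpha by rewrite divr_gt0.
have h1 := ler_wpM2l (ltW Ca) rr.
have h2 := mulr_ge0 (ltW Ca) ej.
rewrite /H /= /C1 /restart_const.
have -> : 2 * Cst / alpha = 2 * (Cst / alpha) by rewrite mulrA.
lra.
Qed.

(** From the kmin-th iterate on, as long as the stopping criterion fails the
    residual dominates the estimator, so the quasi-error inherits its contraction;
    the boundedly many iterates before it only cost a constant. *)
Lemma quasi_error_in_level l j k : active comp stop (l, k) -> (j <= k)%N ->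
  H (l, k) <= in_level_const alpha rbar0 Cst lam kmin * rbar0 ^+ (k - j) * H (l, j).
Proof.
move=> [/= c ns] jk; have [[_ _ _ /andP[r0 r1]] [C0 _ l0]] := adm.
have cj : comp l j by exact: (comp_le compS jk c).
have Hj : 0 <= H (l, j) by exact: quasi_error_ge0.
have C10 : 0 < C1 by exact: (restart_const_gt0 adm).
have rk m : 0 < rbar0 ^+ m by rewrite exprn_gt0.
have p0 : 0 <= rbar0 ^+ (k - j) * H (l, j) by rewrite mulr_ge0 ?(ltW (rk _)).
rewrite /in_level_const -mulrA -/C1 -addrA mulrDl.
have [kk|kk] := leqP kmin k.
  apply: (@le_trans _ _ ((1 + lam^-1) * (rbar0 ^+ (k - j) * H (l, j)))); last first.
    by rewrite lerDr mulr_ge0// divr_ge0 ?(ltW (rk _)) ?(ltW C10).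
  have hl := not_stop c ns kk; rewrite mulrC -ler_pdivlMr// mulrC in hl.
  have hr := residual_geometric c jk.
  have h1 : r l k <= rbar0 ^+ (k - j) * H (l, j).
    by rewrite (le_trans hr)// ler_wpM2l ?(ltW (rk _))// /H lerDl.
  apply: (@le_trans _ _ ((1 + lam^-1) * r l k)).
    by rewrite /H /= mulrDl mul1r lerD2l.
  by rewrite ler_wpM2l// addr_ge0// invr_ge0 ltW.
apply: (@le_trans _ _ (C1 / rbar0 ^+ kmin * (rbar0 ^+ (k - j) * H (l, j)))); last first.
  by rewrite lerDl mulr_ge0// addr_ge0// invr_ge0 ltW.
apply: (le_trans (quasi_error_restart c jk)); rewrite -mulrA ler_pM2l// mulrA ler_peMl//.
rewrite mulrC ler_pdivlMr// mul1r ler_wiXn2l ?(ltW r0) ?(ltW r1)//.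
exact: leq_trans (leq_subr _ _) (ltnW kk).
Qed.

Lemma galerkin_estimator_le l : comp l.+1 0 -> b l <= S * x l.
Proof.
move=> c; have w0 : 0 < w := weight_gt0 adm; have C0 : 0 < Cst := Cst_gt0 adm.
apply: (le_trans (galerkin_estimator c)); rewrite /S /level_stability /x -/w.
have -> : (Cst + w^-1) * (e l + w * h l) =
    h l + Cst * e l + (Cst * (w * h l) + w^-1 * e l).
  by field; rewrite gt_eqF.
rewrite lerDl addr_ge0//; first by rewrite mulr_ge0 ?(ltW C0)// mulr_ge0 ?(ltW w0).
by rewrite mulr_ge0// invr_ge0 ltW.
Qed.

(** Quasi-orthogonality on a single level. *)
Lemma galerkin_dist_le l : comp l.+1 0 -> dist l <= (1 + Corth) * S * x l.
Proof.
move=> c; have S0 : 0 < S := level_stability_gt0 adm.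
have := @quasi_orth l 0; rewrite addn0 big_nat1 => /(_ c) h1.
have [ep0 ep1] := andP (orth_eps_itv adm).
have Sx : 0 <= S * x l by rewrite mulr_ge0 ?level_quantity_ge0 ?ltW.
have h2 : b l ^+ 2 <= (S * x l) ^+ 2 by rewrite ler_pXn2r ?nnegrE// galerkin_estimator_le.
have h3 : dist l ^+ 2 <= (1 + Corth) * (S * x l) ^+ 2.
  have : eps * b l ^+ 2 <= b l ^+ 2 by rewrite ler_piMl ?sqr_ge0 ?(ltW ep1).
  have : Corth * b l ^+ 2 <= Corth * (S * x l) ^+ 2 by rewrite ler_wpM2l ?(ltW Corth_gt0).
  lra.
rewrite -mulrA -(@ler_pXn2r _ 2)// ?nnegrE//; last first.
  by rewrite mulr_ge0// addr_ge0// ltW.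
apply: (le_trans h3); rewrite [leRHS]exprMn ler_wpM2r ?sqr_ge0// expr2 ler_peMr//.
  by rewrite addr_ge0// ltW.
by rewrite lerDl ltW.
Qed.

Lemma quasi_error_next_level l : comp l.+1 0 ->
  H (l.+1, 0%N) <= next_level_const alpha q0 rbar0 Cst kmin Corth * x l.
Proof.
move=> c; have [[a0 /andP[q00 _] _ /andP[r0 _]] _] := adm.
have w0 : 0 < w := weight_gt0 adm.
have [h1 h2] := level_start c; have h3 := galerkin_dist_le c.
rewrite /H /= /next_level_const mulrDl lerD//.
  apply: (le_trans h1); rewrite -[leRHS]mulrA ler_wpM2l//.
    by rewrite divr_ge0 ?exprn_ge0 ?(ltW r0)// mulr_ge0 ?(ltW q00) ?(ltW a0).
  have : e l <= x l by rewrite lerDl mulr_ge0// ltW.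
  by rewrite -/S; lra.
apply: (le_trans h2); rewrite -/w ler_pdivlMl// /x lerDr; exact: e_ge0.
Qed.

Lemma level_quantity_le l j : comp l.+1 0 -> comp l j ->
  x l <= level_end_const alpha q0 Cst * H (l, j).
Proof.
move=> /compL[k [ck sk]] cj; have w0 : 0 < w := weight_gt0 adm.
have [[a0 _ _ _] _] := adm; have ai : 0 < alpha^-1 by rewrite invr_gt0.
have jk : (j <= k)%N.
  by rewrite leqNgt; apply/negP => kj; exact: (comp_before compS kj cj).
have [hE eE] := level_end ck sk; have hr := quasi_error_restart ck jk.
rewrite /level_end_const -/C1 -mulrA.
apply: (@le_trans _ _ ((alpha^-1 + w) * H (l, k))).
  rewrite /x hE /H /=; have := mulr_ge0 (ltW ai) (eta_ge0 l k).
  by have := mulr_ge0 (ltW w0) (r_ge0 ck); lra.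
by rewrite ler_wpM2l// addr_ge0// ltW.
Qed.

(** With the weight chosen above, the level quantity satisfies
    x (l + 1) <= q x l + dist l; by convexity of the square,
    (q x + d)^2 <= q x^2 + d^2 / (1 - q). *)
Lemma level_contraction l : comp l.+2 0 ->
  x l.+1 ^+ 2 <= q * x l ^+ 2 + (1 - q)^-1 * dist l ^+ 2.
Proof.
move=> c; have w0 : 0 < w := weight_gt0 adm; have C0 : 0 < Cst := Cst_gt0 adm.
have [q00 q01] := andP (q0_itv adm).
have [f0 f1] := andP (level_factor_itv adm); rewrite -/q in f0 f1.
have p0 : 0 < 1 - q by rewrite subr_gt0.
have qa : (1 + q0) / 2 <= q by rewrite le_max lexx.
have qm : marking_factor qred theta <= q by rewrite le_max lexx orbT.
have wC : q0 + w * (2 * Cst) = (1 + q0) / 2.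
  by rewrite /w /weight; field; rewrite gt_eqF.
have h0 : x l.+1 <= q * x l + dist l.
  have h1 := level_error c.
  have h2 := ler_wpM2l (ltW w0) (level_estimator c).
  have h3 : w * (marking_factor qred theta * h l) <= q * (w * h l).
    by rewrite mulrCA ler_wpM2r// mulr_ge0// ltW.
  have h4 : (q0 + w * (2 * Cst)) * e l <= q * e l by rewrite wC ler_wpM2r.
  have h5 : (q0 + w * (2 * Cst)) * dist l <= dist l.
    by rewrite wC ler_piMl//; lra.
  rewrite /x; lra.
apply: (@le_trans _ _ ((q * x l + dist l) ^+ 2)).
  rewrite ler_pXn2r ?nnegrE ?level_quantity_ge0//.
  by rewrite addr_ge0// mulr_ge0// level_quantity_ge0.
have -> : q * x l ^+ 2 + (1 - q)^-1 * dist l ^+ 2 = (q * x l + dist l) ^+ 2 +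
    q / (1 - q) * ((1 - q) * x l - dist l) ^+ 2.
  by field; rewrite gt_eqF.
by rewrite lerDl mulr_ge0 ?sqr_ge0// divr_ge0// ltW.
Qed.

(** Quasi-orthogonality bounds the sum of the squared distances by eps times the
    sum of the squared estimators at the Galerkin solutions, and those are bounded
    by the level quantities, so that level_factor_absorb applies. *)
Lemma level_tail_sum l m : (l <= m)%N -> comp m.+1 0 ->
  \sum_(l <= j < m.+1) x j ^+ 2 <=
    level_tail_const q0 qred Cst theta Corth * x l ^+ 2.
Proof.
move=> lm cm; have [f0 f1] := andP (level_factor_itv adm); rewrite -/q in f0 f1.
have S0 : 0 < S := level_stability_gt0 adm.
have [ep0 ep1] := andP (orth_eps_itv adm).
have p0 : 0 <= (1 - q)^-1 by rewrite invr_ge0 subr_ge0 ltW.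
apply: (perturbed_contraction_sum_le (e := fun j => dist j ^+ 2)) => //.
- by move=> j; exact: sqr_ge0.
- exact: level_factor_absorb adm.
- by rewrite addr_ge0// mulr_ge0// mulr_ge0 ?sqr_ge0 ?(ltW ep0).
- move=> j /andP[lj jm]; apply: level_contraction.
  exact: (comp_level_le compS compL) cm.
have bx j : (j <= m)%N -> b j ^+ 2 <= S ^+ 2 * x j ^+ 2.
  move=> jm; rewrite -exprMn ler_pXn2r ?nnegrE ?mulr_ge0 ?level_quantity_ge0 ?(ltW S0)//.
  by apply: galerkin_estimator_le; exact: (comp_level_le compS compL) cm.
have B0 j : 0 <= Corth * S ^+ 2 * x j ^+ 2.
  by rewrite mulr_ge0 ?sqr_ge0// mulr_ge0 ?sqr_ge0// ltW.
(* The sum of the perturbations ends one level before the sum of x. *)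
case: m lm cm bx => [|m] lm cm bx.
  move: lm; rewrite leqn0 => /eqP ->; rewrite !big_geq// mulr0 add0r.
  exact: B0.
move: lm; rewrite leq_eqVlt => /orP[/eqP->|].
  by rewrite !big_geq// mulr0 add0r; exact: B0.
rewrite ltnS => lm.
have := @quasi_orth l (m - l)%N; rewrite subnKC// => /(_ (comp_level_le compS compL (leqnSn _) cm)).
rewrite sumrB -mulr_sumr => h1.
have h2 : \sum_(l <= i < m.+1) b i ^+ 2 <= S ^+ 2 * \sum_(l <= i < m.+1) x i ^+ 2.
  by rewrite mulr_sumr ler_sum_nat// => i /andP[_ im]; exact/bx/ltnW.
have h3 := ler_wpM2l (ltW ep0) h2.
have h4 := ler_wpM2l (ltW Corth_gt0) (bx l (leqW lm)).
rewrite -/eps -/S in h3 h4 *; lra.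
Qed.

Lemma quasi_error_linear n N : (n <= N)%N ->
    active comp stop (nth_step comp stop N) ->
  H (nth_step comp stop N) <=
    Num.sqrt (total_const alpha q0 qred rbar0 Cst theta lam kmin Corth) *
    total_rate alpha q0 qred rbar0 Cst theta lam kmin Corth ^+ (N - n) *
    H (nth_step comp stop n).
Proof.
have [[_ _ _ r01] _] := adm.
apply: (full_linear_convergence compS compL r01
  (in_level_const_ge0 _ adm)
  (level_end_const_ge0 adm) (level_tail_const_ge0 adm Corth_gt0)
  quasi_error_ge0 level_quantity_ge0 quasi_error_in_level quasi_error_next_level level_quantity_le level_tail_sum).
Qed.

End QuasiErrorRecursion.

(** * Boundedness and contraction of the iterates *)

Section Iterates.
Context {R : realType} {X : completeNormedModType R} (d : nat).
Context (VH : mesh R d -> set X) (T0 : mesh R d).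
Context (A : X -> X -> R) (dA : X -> X -> X -> R) (F : X -> R).
Context (eta : mesh R d -> simplex R d -> X -> R).
Context (theta Cmark lam : R) (kmin : nat) (tr : trace X d).
Context (alpha beta qbar q0 B0 delta0 rbar0 : R) (L M : R -> R).
Context (ustarH : mesh R d -> X).
Let c0 := c0_const qbar.
Let Theta := (1 + c0) * B0.
Let Bbar0 := Bbar0_const alpha L c0 B0.
Let C0 := C0_const beta L M c0 B0 Bbar0.
Hypothesis VHsub : forall TH, refinement T0 TH -> is_subspace (VH TH).
Hypothesis VHnest : forall TH Th, refinement T0 TH -> refinement TH Th ->
  VH TH `<=` VH Th.
Hypothesis T0conf : conforming T0.
Hypotheses (dA_ : forall v, in_dual (A v)) (dF : in_dual F) (AF : A 0 <> F).
Hypothesis frA : frechet_derivative A dA.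
Hypothesis monA : strongly_monotone alpha A.
Hypothesis lipA : locally_lipschitz L A.
Hypothesis coA : uniformly_coercive beta dA.
Hypothesis lipdA : derivative_locally_lipschitz M dA.
Hypothesis gus : forall TH, refinement T0 TH ->
  galerkin_solution A F (VH TH) (ustarH TH).
Hypothesis B0E : B0 = B0_const alpha A F.
Hypothesis delta0P : is_delta0 (delta_star C0) delta0.
Hypothesis rbar0E : rbar0 = reduction_factor delta0.
Hypothesis q0E : q0 = L Theta / alpha * rbar0 ^+ kmin.
Hypothesis qbar01 : 0 < qbar < 1.
Hypothesis q0bar : q0 < qbar.
Hypothesis kmin_gt0 : (0 < kmin)%N.
Hypothesis algo : nailfem VH T0 A dA F eta theta Cmark lam kmin tr.

Let comp := computed VH A dA F eta lam kmin tr.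
Let stop l k := stopping VH A F eta lam kmin (tr_mesh tr l) k (tr_u tr l k).
Let res l k := residual VH A F (tr_mesh tr l) (tr_u tr l k).
Let us l := ustarH (tr_mesh tr l).

Lemma alpha_gt0 : 0 < alpha. Proof. by case: monA. Qed.

Lemma c0_gt0 : 0 < c0.
Proof. by case/andP: qbar01 => _ q1; rewrite mulr_gt0// invr_gt0 subr_gt0. Qed.

Lemma B0_gt0 : 0 < B0.
Proof. by rewrite B0E; exact: (B0_const_gt0 dA_ dF monA AF). Qed.

Lemma start_radius_gt0 : 0 < Theta.
Proof. exact: Theta_gt0 c0_gt0 B0_gt0. Qed.

Lemma start_lipschitz_gt0 : 0 < L Theta.
Proof. by have [] := lipA start_radius_gt0. Qed.

Lemma iterate_radius_gt0 : 0 < Bbar0.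
Proof. exact: (Bbar0_gt0 monA c0_gt0 B0_gt0 start_lipschitz_gt0). Qed.

Lemma delta0_itv : 0 < delta0 <= 2^-1.
Proof.
have [[|j] [// _ -> _ _]] := delta0P.
rewrite invr_gt0 exprn_gt0//= lef_pV2 ?posrE ?exprn_gt0//.
by rewrite exprS ler_peMr// exprn_ege1// ler1n.
Qed.

Lemma delta0_le : delta0 <= delta_star C0.
Proof. by have [j [_ -> ]] := delta0P. Qed.

Lemma rbar0_itv : 0 < rbar0 < 1.
Proof.
rewrite rbar0E; apply: reduction_factor_itv.
by case/andP: delta0_itv => -> /le_trans -> //; rewrite invf_le1// ler1n.
Qed.

Lemma newton_step_residual TH u us_ (dmin : R) u' dmin' :
    refinement T0 TH -> galerkin_solution A F (VH TH) us_ -> `|us_| <= B0 ->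
    VH TH u -> residual VH A F TH u <= L Theta * Theta -> delta0 <= dmin ->
    newton_step VH A dA F TH u dmin u' dmin' ->
  [/\ delta0 <= dmin', VH TH u' &
      residual VH A F TH u' <= rbar0 * residual VH A F TH u].
Proof.
move=> rTH gTH usB Vu rT dmin0 [rho [dl [[Vrho newt] ls ->]]].
have sV := VHsub rTH; have [d00 _] := andP delta0_itv.
have sd0 : sufficient_decrease VH A F TH u rho delta0 delta0.
  exact: (damped_newton_decrease dA_ dF monA frA coA lipdA c0_gt0 B0_gt0
    start_lipschitz_gt0 sV gTH usB Vu rT Vrho newt d00 delta0_le).
have [j [j0 delta0E _ _]] := delta0P.
have d1 : 1 = 2 ^- 0 :> R by rewrite expr0 invr1.
have [dmin'0 sd] := line_search_dmin ls d1 delta0E j0 (leq0n j) (fun h => False_ind _ (notF h)) dmin0 sd0.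
split=> //; first by rewrite addrC; case: sV => _; apply.
apply: le_trans sd _; rewrite ler_wpM2r//.
  exact: (residual_on_ge0 dA_ dF).
by rewrite rbar0E reduction_factor_anti.
Qed.

(** The bound by Theta concerns the starting value of the level, not the
    current iterate: later iterates of a level are controlled through their
    residuals only, so that their errors are bounded by Bbar0 but possibly not
    by Theta. *)
Definition invariant l k : Prop :=
  [/\ refinement T0 (tr_mesh tr l), VH (tr_mesh tr l) (tr_u tr l k),
      `|us l - tr_u tr l 0| <= Theta,
      res l k <= rbar0 ^+ k * res l 0 & delta0 <= tr_dmin tr l k].

Lemma us_norm_le l : refinement T0 (tr_mesh tr l) -> `|us l| <= B0.
Proof.
move=> rl; rewrite B0E; exact: (galerkin_norm_le dA_ dF monA (VHsub rl) (gus rl)).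
Qed.

Lemma residual0_le l : refinement T0 (tr_mesh tr l) ->
  `|us l - tr_u tr l 0| <= Theta -> res l 0 <= L Theta * `|us l - tr_u tr l 0|.
Proof.
move=> rl usT.
apply: (residual_le_error (VHsub rl) lipA (gus rl) start_radius_gt0).
rewrite ge_max usT andbT (le_trans (us_norm_le rl))// /Theta ler_peMl//.
  exact: ltW B0_gt0.
by rewrite lerDl ltW// c0_gt0.
Qed.

Lemma rbar0_expr_le1 k : rbar0 ^+ k <= 1.
Proof. by case/andP: rbar0_itv => r0 r1; rewrite exprn_ile1 ?ltW. Qed.

Lemma res_ge0 l k : refinement T0 (tr_mesh tr l) -> 0 <= res l k.
Proof. by move=> rl; exact: (residual_on_ge0 dA_ dF _ (VHsub rl)). Qed.

Lemma invariant_residual_le l k : invariant l k -> res l k <= L Theta * Theta.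
Proof.
move=> [rl Vu usT rk _]; apply: (le_trans rk).
apply: (@le_trans _ _ (res l 0)).
  by rewrite ler_piMl ?rbar0_expr_le1// res_ge0.
by rewrite (le_trans (residual0_le rl usT))// ler_pM2l// start_lipschitz_gt0.
Qed.

Lemma invariant_error_le l k : invariant l k ->
  `|us l - tr_u tr l k| <= alpha^-1 * res l k.
Proof.
by move=> [rl Vu _ _ _]; exact: (error_le_residual dA_ dF monA (VHsub rl) (gus rl)).
Qed.

(** At least kmin Newton steps reduce the residual by rbar0^kmin; the passage from
    error to residual costs L Theta, the way back 1 / alpha. *)
Lemma invariant_next l k : invariant l k -> (kmin <= k)%N ->
  `|us l - tr_u tr l k| <= q0 * `|us l - tr_u tr l 0|.
Proof.
move=> Ilk kk; have [rl Vu usT rk _] := Ilk.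
apply: (le_trans (invariant_error_le Ilk)).
have a0 := alpha_gt0; have [r0 r1] := andP rbar0_itv.
rewrite ler_pdivrMl//; apply: (le_trans rk).
apply: (@le_trans _ _ (rbar0 ^+ kmin * res l 0)).
  by rewrite ler_wpM2r ?res_ge0// ler_wiXn2l// ltW.
apply: (@le_trans _ _ (rbar0 ^+ kmin * (L Theta * `|us l - tr_u tr l 0|))).
  by rewrite ler_wpM2l ?exprn_ge0 ?residual0_le// ltW.
rewrite q0E le_eqVlt; apply/orP; left; apply/eqP.
by field; rewrite gt_eqF.
Qed.

(** Changing the space moves the Galerkin solution by at most 2 B0, and the cycle
    before it has multiplied the error by q0 < qbar.  The radius
    Theta = (1 + c0) B0 is stable under this recursion because
    qbar Theta + 2 B0 <= Theta, and everything needed for the next Newton step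
    follows from an initial error at most Theta. *)
Lemma invariant_computed l k : comp l k -> invariant l k.
Proof.
have [m0 u0 dm0 Nstep Rstep] := algo.
have [B00 c00] := (B0_gt0, c0_gt0).
have [q1 q2] := andP qbar01.
elim=> {l k} [|l k u' dmin' c IH ns st|l k c IH st].
- have r0 : refinement T0 (tr_mesh tr 0) by rewrite m0; exact: refinement_refl.
  split=> //.
  + by rewrite u0; have [] := VHsub r0.
  + by rewrite u0 subr0 (le_trans (us_norm_le r0))// /Theta ler_peMl ?ltW// ltrDl.
  + by rewrite expr0 mul1r.
  + by rewrite dm0; case/andP: delta0_itv.
- have cS : comp l k.+1 by apply: computed_newton c ns st.
  have [rl Vu usT rk dk] := IH.
  have [dk' Vu' rk'] := newton_step_residual rl (gus rl) (us_norm_le rl) Vu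
     (invariant_residual_le IH) dk (Nstep _ _ cS).
  split=> //; rewrite /res (le_trans rk')// exprS -mulrA ler_wpM2l//.
  by case/andP: rbar0_itv => /ltW.
- have [rl Vu usT rk dk] := IH.
  have [[MH _ [[rS _] _]] uE dE] := Rstep _ _ c st.
  have rlS : refinement T0 (tr_mesh tr l.+1) := refinement_trans rl rS.
  split=> //; last by rewrite dE.
  + by rewrite uE; exact: (VHnest rl rS).
  + rewrite uE; have [kk _] := st; have h := invariant_next IH kk.
    have := us_norm_le rl; have := us_norm_le rlS => h1 h2.
    have -> : us l.+1 - tr_u tr l k = (us l.+1 - us l) + (us l - tr_u tr l k).
      by rewrite addrA subrK.
    apply: (le_trans (ler_normD _ _)); apply: (le_trans (lerD (ler_normB _ _) h)).
    have h3 : q0 * `|us l - tr_u tr l 0| <= qbar * Theta.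
      rewrite (@le_trans _ _ (qbar * `|us l - tr_u tr l 0|))//.
        by rewrite ler_wpM2r// ltW.
      by rewrite ler_wpM2l// ltW.
    have h4 : (1 - qbar) * Theta = (1 - qbar) * B0 + 2 * B0.
      by rewrite /Theta /c0 /c0_const; field; rewrite gt_eqF// subr_gt0.
    have h5 : 0 <= (1 - qbar) * B0 by rewrite mulr_ge0 ?subr_ge0 ?ltW.
    lra.
  + by rewrite expr0 mul1r.
Qed.

(** * Quasi-error of the algorithm *)

Context (qred Cst : R) (Cstab Corth : R -> R).
Hypothesis stabE : stability VH T0 eta Cstab.
Hypothesis redE : reduction VH T0 eta qred.
Hypothesis CstE : Cst = Cstab (2 * Bbar0).
Hypotheses (theta01 : 0 < theta <= 1) (lam_gt0 : 0 < lam).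
Hypothesis qo : quasi_orthogonality VH A dA F eta lam kmin tr ustarH Corth.
Let etal l v := eta_tot eta (tr_mesh tr l) v.
Let e l := `|us l - tr_u tr l.+1 0|.
Let dist l := `|us l.+1 - us l|.

Lemma nailfem_admissible : admissible alpha q0 qred rbar0 Cst theta lam.
Proof.
have a0 := alpha_gt0; have r01 := rbar0_itv; have [r0 _] := andP r01.
have [q1 q2] := andP qbar01; have [qr _] := redE.
have B20 : 0 < 2 * Bbar0 by rewrite mulr_gt0// iterate_radius_gt0.
have [Cst0 _] := stabE B20; rewrite -CstE in Cst0.
split; split=> //; rewrite (lt_trans q0bar q2) andbT q0E.
by rewrite mulr_gt0 ?exprn_gt0// divr_gt0// start_lipschitz_gt0.
Qed.

Lemma us_norm_le_Bbar0 l : refinement T0 (tr_mesh tr l) -> `|us l| <= Bbar0.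
Proof.
move=> rl; apply: (le_trans (us_norm_le rl)); rewrite /Bbar0 Bbar0E lerDr.
by rewrite mulr_ge0 ?invr_ge0 ?(ltW alpha_gt0)// mulr_ge0 ?(ltW start_lipschitz_gt0) ?(ltW start_radius_gt0).
Qed.

Lemma iterate_norm_le l k : comp l k -> `|tr_u tr l k| <= Bbar0.
Proof.
move=> c; have I := invariant_computed c; have [rl _ _ _ _] := I.
rewrite -(subKr (us l) (tr_u tr l k)) (le_trans (ler_normB _ _))//.
rewrite /Bbar0 Bbar0E addrC lerD// ?us_norm_le//.
apply: (le_trans (invariant_error_le I)).
by rewrite ler_pM2l ?invr_gt0 ?alpha_gt0//; exact: invariant_residual_le.
Qed.

Lemma level_transition l k : comp l k -> stop l k ->
  [/\ refinement (tr_mesh tr l) (tr_mesh tr l.+1),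
      tr_u tr l.+1 0 = tr_u tr l k &
      exists2 MH, doerfler eta theta (tr_mesh tr l) (tr_u tr l k) MH &
        [disjoint MH & tr_mesh tr l.+1]%fset].
Proof.
have [_ _ _ _ Rstep] := algo.
move=> c st; have [[MH [dM _] [[rS dis] _]] uE _] := Rstep _ _ c st.
by split=> //; exists MH.
Qed.

Lemma level_mesh l : comp l 0 ->
  refinement T0 (tr_mesh tr l) /\ conforming (tr_mesh tr l).
Proof. by case/invariant_computed => rl _ _ _ _; split=> //; case: rl. Qed.

Lemma iterate_in l k : comp l k -> VH (tr_mesh tr l) (tr_u tr l k).
Proof. by case/invariant_computed. Qed.

Lemma us_in l : refinement T0 (tr_mesh tr l) -> VH (tr_mesh tr l) (us l).
Proof. by move=> /gus[]. Qed.

Lemma comp_level0 l k : comp l k -> comp l 0.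
Proof. by apply: (@comp_le comp stop (@computedS_inv _ _ _ _ _ _ _ _ _ _ _)). Qed.

Lemma etal_stable l v w : comp l 0 -> VH (tr_mesh tr l) v ->
    VH (tr_mesh tr l) w -> `|v| <= Bbar0 -> `|w| <= Bbar0 ->
  etal l v <= etal l w + Cst * `|v - w|.
Proof.
move=> /level_mesh[rl cl] Vv Vw vB wB.
by rewrite CstE; apply: (eta_tot_stable stabE iterate_radius_gt0).
Qed.

Lemma iterate_dist_le l j k : comp l j -> comp l k ->
  `|tr_u tr l k - tr_u tr l j| <= alpha^-1 * (res l k + res l j).
Proof.
move=> /invariant_computed/invariant_error_le hj.
move=> /invariant_computed/invariant_error_le hk.
have -> : tr_u tr l k - tr_u tr l j =
    (us l - tr_u tr l j) - (us l - tr_u tr l k).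
  by rewrite opprB [RHS]addrC addrA subrK.
by apply: (le_trans (ler_normB _ _)); rewrite mulrDr addrC lerD.
Qed.

Lemma restart_error_le l :
  `|us l.+1 - tr_u tr l.+1 0| <= dist l + e l.
Proof.
have -> : us l.+1 - tr_u tr l.+1 0 = (us l.+1 - us l) + (us l - tr_u tr l.+1 0).
  by rewrite addrA subrK.
exact: ler_normD.
Qed.

(** The final iterate of level l is read off as the initial one of level l + 1;
    it still lies in the smaller space. *)
Lemma level_end_in l : comp l.+1 0 ->
  VH (tr_mesh tr l) (tr_u tr l.+1 0) /\ `|tr_u tr l.+1 0| <= Bbar0.
Proof.
case/computed_level_inv => k [c st]; have [_ -> _] := level_transition c st.
by split; [exact: iterate_in|exact: iterate_norm_le].
Qed.

(** Interprets the recursion for the quasi-error in the algorithm.  The initial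
    error of level l + 1 is at most dist l + e l, which feeds both the residual
    at the start of that level and the error at its end. *)
Lemma nailfem_quasi_error n N : (n <= N)%N ->
    active comp stop (nth_step comp stop N) ->
  quasi_error VH A F eta tr (nth_step comp stop N) <=
    Num.sqrt (total_const alpha q0 qred rbar0 Cst theta lam kmin
      (Corth (orth_eps q0 qred Cst theta))) *
    total_rate alpha q0 qred rbar0 Cst theta lam kmin
      (Corth (orth_eps q0 qred Cst theta)) ^+ (N - n) *
    quasi_error VH A F eta tr (nth_step comp stop n).
Proof.
have adm := nailfem_admissible; have a0 := alpha_gt0.
have ep01 := orth_eps_itv adm.
have [Co0 qoe] := qo ep01.
have Cst0 : 0 < Cst := Cst_gt0 adm.
apply: (@quasi_error_linear _ _ _ _ _ _ _ _ _ _ adm Co0 comp stop _ _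
  res (fun l k => etal l (tr_u tr l k)) e (fun l => etal l (tr_u tr l.+1 0))
  dist (fun l => etal l (us l))).
- by move=> l k; exact: computedS_inv.
- by move=> l; exact: computed_level_inv.
- by move=> l k /invariant_computed[rl _ _ _ _]; exact: res_ge0.
- by move=> l k; exact: eta_on_ge0.
- by move=> l; exact: normr_ge0.
- by move=> l; exact: eta_on_ge0.
- by move=> l; exact: normr_ge0.
- by move=> l; exact: eta_on_ge0.
- move=> l k cS; have [c _] := computedS_inv cS.
  have I := invariant_computed c; have [rl Vu _ _ dk] := I.
  have [_ _ _ Nstep _] := algo.
  by have [] := newton_step_residual rl (gus rl) (us_norm_le rl) Vu
     (invariant_residual_le I) dk (Nstep _ _ cS).
- move=> l j k cj ck; have h := iterate_dist_le cj ck.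
  apply: (le_trans (etal_stable (comp_level0 ck) (iterate_in ck)
    (iterate_in cj) (iterate_norm_le ck) (iterate_norm_le cj))).
  by rewrite lerD2l -mulrA ler_pM2l.
- move=> l k c ns kk; rewrite leNgt; apply/negP => lt; apply: ns.
  by split=> //; exact: ltW.
- move=> l k c st; have [_ uE _] := level_transition c st; rewrite /e uE.
  by split=> //; apply: invariant_error_le; exact: invariant_computed.
- move=> l cS; have [rS _ usT _ _] := invariant_computed cS.
  have [k [c st]] := computed_level_inv cS.
  have [rr uE _] := level_transition c st; have [rl _] := level_mesh (comp_level0 c).
  split; last by apply: (eta_refine_mono VHnest stabE redE) => //; case: (level_end_in cS).
  apply: (le_trans (residual0_le rS usT)).
  have [r0 _] := andP rbar0_itv.
  have -> : q0 * alpha / rbar0 ^+ kmin = L Theta.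
    have an0 : alpha != 0 by rewrite gt_eqF.
    have rn0 : rbar0 != 0 by rewrite gt_eqF.
    by rewrite q0E; field; rewrite ?an0 ?rn0 ?expf_neq0.
  by rewrite ler_pM2l ?start_lipschitz_gt0// restart_error_le.
- move=> l /computed_level_inv[k [c st]].
  have [_ uE _] := level_transition c st; have [kk _] := st.
  rewrite /e uE; apply: (le_trans (invariant_next (invariant_computed c) kk)).
  have [q00 _] := andP (q0_itv adm).
  by rewrite ler_pM2l// [leRHS]addrC restart_error_le.
- move=> l cSS; have [k [c st]] := computed_level_inv cSS.
  have [_ uE _] := level_transition c st; have [kk _] := st.
  have cS := comp_level0 c; have [k' [c' st']] := computed_level_inv cS.
  have [rr' uE' [MH dM dis]] := level_transition c' st'.
  have [rl _] := level_mesh (comp_level0 c').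
  have h1 : etal l.+1 (tr_u tr l.+1 0) <=
      marking_factor qred theta * etal l (tr_u tr l.+1 0).
    have [Vl _] := level_end_in cS; rewrite -uE' in dM.
    have [m0 _] := andP (marking_factor_itv adm).
    have mE : marking_factor qred theta ^+ 2 = 1 - (1 - qred ^+ 2) * theta.
      have [t0 t1] := andP theta01; have [/andP[qr0 qr1] _] := redE.
      have qr2 : qred ^+ 2 <= 1 by rewrite exprn_ile1 ?(ltW qr0) ?(ltW qr1).
      have qr3 := sqr_ge0 qred.
      by apply: sqr_sqrtr; rewrite subr_ge0 mulr_ile1 ?(ltW t0)//; lra.
    rewrite -(@ler_pXn2r _ 2)// ?nnegrE ?mulr_ge0 ?eta_on_ge0// exprMn mE.
    exact: (doerfler_reduction VHnest stabE redE rl rr' Vl dM dis).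
  have h2 := restart_error_le l; have [q00 q01] := andP (q0_itv adm).
  have h3 := invariant_next (invariant_computed c) kk.
  have h4 : `|tr_u tr l.+1 k - tr_u tr l.+1 0| <= 2 * (e l + dist l).
    have -> : tr_u tr l.+1 k - tr_u tr l.+1 0 =
        (us l.+1 - tr_u tr l.+1 0) - (us l.+1 - tr_u tr l.+1 k).
      by rewrite opprB [RHS]addrC addrA subrK.
    have h5 : q0 * `|us l.+1 - tr_u tr l.+1 0| <= `|us l.+1 - tr_u tr l.+1 0|.
      by rewrite ler_piMl// ltW.
    by apply: (le_trans (ler_normB _ _)); lra.
  rewrite uE; have := etal_stable cS (iterate_in c) (iterate_in cS)
    (iterate_norm_le c) (iterate_norm_le cS).
  by have := ler_wpM2l (ltW Cst0) h4; lra.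
- move=> l cS; have [k [c st]] := computed_level_inv cS.
  have [rl _] := level_mesh (comp_level0 c); have [Ve eB] := level_end_in cS.
  exact: etal_stable (comp_level0 c) (us_in rl) Ve (us_norm_le_Bbar0 rl) eB.
- move=> l n' c; apply: qoe; exists (l + n').+1 => //.
  by rewrite Qset_active//; split=> //; exact: not_stop0.
Qed.

Lemma nailfem_full_linear lk lk' :
  let Q := Qset VH A dA F eta lam kmin tr in
  let count := step_counter VH A dA F eta lam kmin tr in
  let Corth_eps := Corth (orth_eps q0 qred Cst theta) in
  Q lk -> Q lk' -> (count lk' <= count lk)%N ->
  quasi_error VH A F eta tr lk <=
    Num.sqrt (total_const alpha q0 qred rbar0 Cst theta lam kmin Corth_eps) *
    total_rate alpha q0 qred rbar0 Cst theta lam kmin Corth_eps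
      ^+ (count lk - count lk') *
    quasi_error VH A F eta tr lk'.
Proof.
move=> Q count Corth_eps; rewrite /Q Qset_active// => Qlk Qlk'.
have surj := nth_step_surj (@computedS_inv _ _ _ VH A dA F eta lam kmin tr)
  (@computed_level_inv _ _ _ VH A dA F eta lam kmin tr)
  (@not_stop0 _ _ _ VH A F eta lam kmin tr kmin_gt0).
have [N NE] := surj _ Qlk; have [n nE] := surj _ Qlk'.
rewrite NE nE in Qlk Qlk' *.
rewrite /count !step_counter_nth// => nN; exact: nailfem_quasi_error.
Qed.

End Iterates.

(** * Full linear convergence *)

Theorem theorem12 (R : realType)
    (alpha delta0 q0 qred rbar0 B0 Cstabbar Ccea Crel theta lam : R)
    (kmin : nat) :
  exists2 eps : R, 0 < eps < 1 &
  forall Corth_eps : R,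
  exists Clin qlin : R, 0 < Clin /\ 0 < qlin < 1 /\
  forall (d p : nat) (Omega : set 'rV[R]_d) (T0 : mesh R d)
    (X : completeNormedModType R) (ip : X -> X -> R)
    (iota : ('rV[R]_d -> R) -> X)
    (A : X -> X -> R) (dA : X -> X -> X -> R) (F : X -> R)
    (L M : R -> R) (beta : R) (ustar : X) (ustarH : mesh R d -> X)
    (eta : mesh R d -> simplex R d -> X -> R) (Cstab Corth : R -> R)
    (qbar Cmark : R) (tr : trace X d),
  let VH := fe_space Omega iota p in
  let c0 := c0_const qbar in
  let Bbar0 := Bbar0_const alpha L c0 B0 in
  let C0 := C0_const beta L M c0 B0 Bbar0 in
  (* meshes and spaces *)
  (0 < d)%N -> (0 < p)%N ->
  bounded_lipschitz_domain Omega ->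
  conforming_triangulation Omega T0 ->
  inner_product_norm ip ->
  embeds_H10 Omega iota ->
  (* nonlinear problem *)
  (forall v, in_dual (A v)) -> in_dual F -> A 0 <> F ->
  frechet_derivative A dA ->
  strongly_monotone alpha A ->
  locally_lipschitz L A ->
  uniformly_coercive beta dA ->
  derivative_locally_lipschitz M dA ->
  galerkin_solution A F setT ustar ->
  (forall TH, refinement T0 TH ->
     galerkin_solution A F (VH TH) (ustarH TH)) ->
  (* estimator *)
  estimator_nonneg VH T0 eta ->
  stability VH T0 eta Cstab ->
  reduction VH T0 eta qred ->
  reliability T0 eta ustar ustarH Crel ->
  (* constants *)
  B0 = B0_const alpha A F ->
  is_delta0 (delta_star C0) delta0 ->
  rbar0 = reduction_factor delta0 ->
  Ccea = L (2 * B0) / alpha ->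
  Cstabbar = Cstab (2 * Bbar0) ->
  q0 = L ((1 + c0) * B0) / alpha * rbar0 ^+ kmin ->
  0 < qbar < 1 -> (0 < kmin)%N -> q0 < qbar ->
  (* algorithm *)
  0 < theta <= 1 -> 1 <= Cmark -> 0 < lam ->
  nailfem VH T0 A dA F eta theta Cmark lam kmin tr ->
  quasi_orthogonality VH A dA F eta lam kmin tr ustarH Corth ->
  Corth_eps = Corth eps ->
  let Q := Qset VH A dA F eta lam kmin tr in
  let count := step_counter VH A dA F eta lam kmin tr in
  let H := quasi_error VH A F eta tr in
  forall lk lk' : nat * nat, Q lk -> Q lk' -> (count lk' <= count lk)%N ->
    H lk <= Clin * qlin ^+ (count lk - count lk') * H lk'.
Proof.
(* The constants are chosen before the problem; parameters that no problem can
   have get arbitrary values. *)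
have [eps [eps01 epsE]] : exists eps : R, 0 < eps < 1 /\
    (admissible alpha q0 qred rbar0 Cstabbar theta lam ->
     eps = orth_eps q0 qred Cstabbar theta).
  have [adm|nadm] := pselect (admissible alpha q0 qred rbar0 Cstabbar theta lam).
    by exists (orth_eps q0 qred Cstabbar theta); split=> //; exact: orth_eps_itv adm.
  by exists 2^-1; split=> [|/nadm//]; rewrite invr_gt0 ltr0n invf_lt1// ltr1n.
exists eps => // Co.
have [Clin [qlin [C0 [q01 CqE]]]] : exists Clin qlin : R,
    0 < Clin /\ 0 < qlin < 1 /\
    (admissible alpha q0 qred rbar0 Cstabbar theta lam -> 0 < Co ->
     Clin = Num.sqrt (total_const alpha q0 qred rbar0 Cstabbar theta lam kmin Co) /\
     qlin = total_rate alpha q0 qred rbar0 Cstabbar theta lam kmin Co).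
  have [[adm Co0]|nadm] := pselect
    (admissible alpha q0 qred rbar0 Cstabbar theta lam /\ 0 < Co).
    exists (Num.sqrt (total_const alpha q0 qred rbar0 Cstabbar theta lam kmin Co)).
    exists (total_rate alpha q0 qred rbar0 Cstabbar theta lam kmin Co).
    split; first by rewrite sqrtr_gt0 (total_const_gt0 _ adm).
    by split=> //; exact: total_rate_itv adm Co0.
  exists 1, 2^-1; split=> //; split; first by rewrite invr_gt0 ltr0n invf_lt1// ltr1n.
  by move=> adm Co0; case: nadm.
exists Clin, qlin; split=> //; split=> //.
move=> d p Omega T0 X ip iota A dA F L M beta ustar ustarH eta Cstab Corth qbar
  Cmark tr VH c0 Bbar0 C1 _ _ [oOmega _ _ _ _] cT0 _ embed dA_ dF AF frA monA lipA
  coA lipdA _ gus _ stabE redE _ B0E delta0P rbar0E _ CstE q0E qbar01 kmin0 q0bar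
  theta01 _ lam0 algo qo CoE Q count H lk lk' Qlk Qlk' le_count.
have T0conf : conforming T0 by case: cT0.
have VHnest TH Th : refinement T0 TH -> refinement TH Th -> VH TH `<=` VH Th.
  by move=> rH rh; exact: fe_space_refine cT0 rH rh.
have VHlin TH (a : R) x y : VH TH x -> VH TH y -> VH TH (a *: x + y).
  exact: fe_space_lin.
have VHsub TH : refinement T0 TH -> is_subspace (VH TH).
  move=> rH; split=> [|a x y]; last exact: VHlin.
  (* The space contains the Galerkin solution, hence also 0. *)
  by have [Vu _] := gus _ rH; have := VHlin TH (-1) _ _ Vu Vu; rewrite scaleN1r addNr.
have adm : admissible alpha q0 qred rbar0 Cstabbar theta lam.
  exact: (nailfem_admissible dA_ dF AF monA lipA B0E delta0P rbar0E q0E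
    qbar01 q0bar stabE redE CstE theta01 lam0).
have Co0 : 0 < Co by rewrite CoE; have [] := qo _ eps01.
have [-> ->] := CqE adm Co0; rewrite CoE (epsE adm).
exact: (nailfem_full_linear VHsub VHnest T0conf dA_ dF AF frA monA lipA coA lipdA
  gus B0E delta0P rbar0E q0E qbar01 q0bar kmin0 algo stabE redE CstE theta01
  lam0 qo Qlk Qlk' le_count).
Qed.
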